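(* Assume that the generalized $d_a$-projection $\mathfrak{P}(\overline{\bm p}_{sa};\bm b,\beta)$ can be computed exactly in time $\mathcal{O}(h(S))$. Then, for any $\bm v\in[0,\overline R]^S$, the robust Bellman iterate $\mathfrak{B}(\bm v)$ can be computed for all states $s\in\mathcal{S}$ to accuracy $\epsilon>0$, i.e., one can compute $\bm v'\in\mathbb{R}^S$ with $\lVert \bm v'-\mathfrak{B}(\bm v)\rVert_\infty\le\epsilon$, in time $\mathcal{O}(A S\cdot h(S)\cdot\log[\overline R/\epsilon])$.
   Context: $\mathcal{S}=\{1,\dots,S\}$ and $\mathcal{A}=\{1,\dots,A\}$ are finite state and action spaces, $\Delta_n=\{\bm p\in\mathbb{R}^n_+:\mathbf{e}^\top\bm p=1\}$ is the probability simplex ($\mathbf{e}$ is the all-ones vector), $\bm r_{sa}=(r_{sas'})_{s'\in\mathcal{S}}\in\mathbb{R}^S_+$ are non-negative rewards, $\lambda\in(0,1)$ is a discount factor, and $\overline{\bm p}_{sa}\in\Delta_S$ are nominal transition probabilities. For each $s\in\mathcal{S}$, the ambiguity set is $$\mathcal{P}_s=\Big\{\bm p_s=(\bm p_{s1},\dots,\bm p_{sA})\in(\Delta_S)^A:\ \sum_{a\in\mathcal{A}}d_a(\bm p_{sa},\overline{\bm p}_{sa})\le\kappa\Big\},$$ where the deviation functions $d_a:\Delta_S\times\Delta_S\to\mathbb{R}$ are convex in their first argument for fixed second argument, non-negative, and satisfy $d_a(\bm p,\bm p')=0$ if and only if $\bm p=\bm p'$; the budget satisfies $\kappa>0$. The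 robust Bellman operator is defined by $$[\mathfrak{B}(\bm v)]_s=\max_{\bm\pi_s\in\Delta_A}\ \min_{\bm p_s\in\mathcal{P}_s}\ \sum_{a\in\mathcal{A}}\pi_{sa}\,\bm p_{sa}^\top(\bm r_{sa}+\lambda\bm v),\qquad s\in\mathcal{S}.$$ For $\bm b\in\mathbb{R}^S_+$ and $\beta\in\mathbb{R}_+$, the generalized $d_a$-projection is the optimal value $$\mathfrak{P}(\overline{\bm p}_{sa};\bm b,\beta)=\min\{d_a(\bm p_{sa},\overline{\bm p}_{sa}):\ \bm b^\top\bm p_{sa}\le\beta,\ \bm p_{sa}\in\Delta_S\},$$ which is feasible if and only if $\min_i b_i\le\beta$ (value $+\infty$ otherwise). Finally, $\overline R=[1-\lambda]^{-1}\max\{r_{sas'}:s,s'\in\mathcal{S},a\in\mathcal{A}\}$. Time counts elementary arithmetic operations; evaluating $d_a$ is assumed to take time $\mathcal{O}(1)$ if one of its arguments is a Dirac distribution and $\mathcal{O}(S)$ otherwise. *)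

(* Defs.v *)
(* MathComp-Analysis *)
From HB Require Import structures.
From mathcomp Require Import all_boot all_order all_algebra.
From mathcomp Require Import all_classical all_reals.
From mathcomp Require Import ereal normedtype exp.
Set Implicit Arguments.
Unset Strict Implicit.
Unset Printing Implicit Defensive.
Import Order.TTheory GRing.Theory Num.Theory.
Local Open Scope classical_set_scope.
Local Open Scope ring_scope.

Section RobustMDP.
Variable R : realType.

Definition simplex (n : nat) : set 'rV[R]_n :=
  [set p | (forall i, 0 <= p 0 i) /\ \sum_i p 0 i = 1].

Definition dot (n : nat) (x y : 'rV[R]_n) : R := \sum_i x 0 i * y 0 i.

(* One deviation function per action.  The values outside the simplex are
   irrelevant: they are never constrained, and no program can query them. *)
Definition deviations (nS nA : nat) := 'I_nA -> 'rV[R]_nS -> 'rV[R]_nS -> R.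

Definition deviation_axioms (nS nA : nat) (d : deviations nS nA) : Prop :=
  forall a (q : 'rV[R]_nS), simplex q ->
    [/\ (forall (p p' : 'rV[R]_nS) (t : R),
           simplex p -> simplex p' -> 0 <= t <= 1 ->
           d a (t *: p + (1 - t) *: p') q
             <= t * d a p q + (1 - t) * d a p' q),
        (forall p, simplex p -> 0 <= d a p q)
      & (forall p, simplex p -> (d a p q = 0 <-> p = q))].

(* The infimum over the empty set is +oo. *)
Definition projection (nS nA : nat) (d : deviations nS nA) (a : 'I_nA)
    (pbar b : 'rV[R]_nS) (beta : R) : \bar R :=
  ereal_inf [set (d a p pbar)%:E | p in
               [set p : 'rV[R]_nS | dot b p <= beta /\ simplex p]].

Definition ambiguity (nS nA : nat) (d : deviations nS nA)
    (pbar_s : 'I_nA -> 'rV[R]_nS) (kappa : R) : set ('I_nA -> 'rV[R]_nS) :=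
  [set p | (forall a, simplex (p a)) /\
           \sum_a d a (p a) (pbar_s a) <= kappa].

(* The minimum is an infimum because the deviation functions need not be lower
   semicontinuous on the boundary of the simplex; sup and inf coincide with max
   and min as soon as the latter are attained. *)
Definition bellman (nS nA : nat) (d : deviations nS nA)
    (r pbar : 'I_nS -> 'I_nA -> 'rV[R]_nS) (lambda kappa : R)
    (v : 'rV[R]_nS) : 'rV[R]_nS :=
  \row_s sup [set inf [set \sum_a pi 0 a * dot (p a) (r s a + lambda *: v)
                      | p in ambiguity d (pbar s) kappa]
             | pi in @simplex nA].

(* Folding from 0 is harmless: rewards are non-negative. *)
Definition Rbar (nS nA : nat) (r : 'I_nS -> 'I_nA -> 'rV[R]_nS)
    (lambda : R) : R :=
  (1 - lambda)^-1 * \big[Num.max/0]_(i : 'I_nS * 'I_nA * 'I_nS)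
                      r i.1.1 i.1.2 0 i.2.

End RobustMDP.

(* Real random access machine: a program is a finite text, independent of the
   instance and of its size, acting on named integer variables (used for
   indices and counters) and named arrays of real numbers. *)

Inductive iexp :=
| IConst of nat
| IVar of nat
| IAdd of iexp & iexp
| ISub of iexp & iexp
| IMul of iexp & iexp.

Inductive rexp :=
| RNat of iexp
| RGet of nat & iexp
| RAdd of rexp & rexp
| RSub of rexp & rexp
| RMul of rexp & rexp
| RDiv of rexp & rexp.

Inductive bexp :=
| BLeI of iexp & iexp
| BLeR of rexp & rexp
| BNot of bexp.

(* [CDev x e a y i z j] stores in cell e of array x the deviation d_a between
   the vectors held in array y from cell i on and in array z from cell j on. *)
Inductive cmd :=
| CSkip
| CSeq of cmd & cmd
| CIf of bexp & cmd & cmd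
| CWhile of bexp & cmd
| CSetI of nat & iexp
| CSetR of nat & iexp & rexp
| CDev of nat & iexp & iexp & nat & iexp & nat & iexp.

(* Running times: every operation, constant and memory access costs 1. *)
Fixpoint itime (e : iexp) : nat :=
  match e with
  | IConst _ | IVar _ => 1
  | IAdd e1 e2 | ISub e1 e2 | IMul e1 e2 => (itime e1 + itime e2).+1
  end.

Fixpoint rtime (e : rexp) : nat :=
  match e with
  | RNat e1 | RGet _ e1 => (itime e1).+1
  | RAdd e1 e2 | RSub e1 e2 | RMul e1 e2 | RDiv e1 e2 =>
      (rtime e1 + rtime e2).+1
  end.

Fixpoint btime (b : bexp) : nat :=
  match b with
  | BLeI e1 e2 => (itime e1 + itime e2).+1
  | BLeR e1 e2 => (rtime e1 + rtime e2).+1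
  | BNot b1 => (btime b1).+1
  end.

Section Semantics.
Variable R : realType.

Record state := State { ivar : nat -> nat; rarr : nat -> nat -> R }.

Definition set_ivar (st : state) (x n : nat) : state :=
  State (fun y => if y == x then n else ivar st y) (rarr st).

Definition set_rarr (st : state) (x i : nat) (w : R) : state :=
  State (ivar st)
        (fun y j => if (y == x) && (j == i) then w else rarr st y j).

Fixpoint ieval (st : state) (e : iexp) : nat :=
  match e with
  | IConst n => n
  | IVar x => ivar st x
  | IAdd e1 e2 => (ieval st e1 + ieval st e2)%N
  | ISub e1 e2 => (ieval st e1 - ieval st e2)%N
  | IMul e1 e2 => (ieval st e1 * ieval st e2)%N
  end.

Fixpoint reval (st : state) (e : rexp) : R :=
  match e with
  | RNat e1 => (ieval st e1)%:R
  | RGet x e1 => rarr st x (ieval st e1)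
  | RAdd e1 e2 => reval st e1 + reval st e2
  | RSub e1 e2 => reval st e1 - reval st e2
  | RMul e1 e2 => reval st e1 * reval st e2
  | RDiv e1 e2 => reval st e1 / reval st e2
  end.

Fixpoint beval (st : state) (b : bexp) : bool :=
  match b with
  | BLeI e1 e2 => (ieval st e1 <= ieval st e2)%N
  | BLeR e1 e2 => reval st e1 <= reval st e2
  | BNot b1 => ~~ beval st b1
  end.

Definition slice (n : nat) (st : state) (x i : nat) : 'rV[R]_n :=
  \row_(j < n) rarr st x (i + j).

Definition dirac (n : nat) (p : 'rV[R]_n) : bool :=
  [exists i, p == delta_mx 0 i].

Definition dev_time (n : nat) (p q : 'rV[R]_n) : nat :=
  if dirac p || dirac q then 1%N else n.

(* [exec d c st st' k]: started in memory st, the program c halts in memory st'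
   after time k.  Execution is deterministic, and blocks on a deviation query
   whose arguments are not an action and two probability vectors. *)
Inductive exec (nS nA : nat) (d : deviations R nS nA) :
    cmd -> state -> state -> nat -> Prop :=
| ExecSkip st : exec d CSkip st st 0
| ExecSeq c1 c2 st st1 st2 k1 k2 :
    exec d c1 st st1 k1 -> exec d c2 st1 st2 k2 ->
    exec d (CSeq c1 c2) st st2 (k1 + k2)
| ExecIfT b c1 c2 st st' k :
    beval st b -> exec d c1 st st' k ->
    exec d (CIf b c1 c2) st st' (btime b + k)
| ExecIfF b c1 c2 st st' k :
    ~~ beval st b -> exec d c2 st st' k ->
    exec d (CIf b c1 c2) st st' (btime b + k)
| ExecWhileT b c st st1 st2 k1 k2 :
    beval st b -> exec d c st st1 k1 -> exec d (CWhile b c) st1 st2 k2 ->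
    exec d (CWhile b c) st st2 (btime b + k1 + k2)
| ExecWhileF b c st :
    ~~ beval st b -> exec d (CWhile b c) st st (btime b)
| ExecSetI x e st :
    exec d (CSetI x e) st (set_ivar st x (ieval st e)) (itime e).+1
| ExecSetR x e f st :
    exec d (CSetR x e f) st (set_rarr st x (ieval st e) (reval st f))
         (itime e + rtime f).+1
| ExecDev x e ea y i z j st (a : 'I_nA) (p q : 'rV[R]_nS) :
    ieval st ea = a ->
    p = slice nS st y (ieval st i) -> q = slice nS st z (ieval st j) ->
    simplex p -> simplex q ->
    exec d (CDev x e ea y i z j) st
         (set_rarr st x (ieval st e) (d a p q))
         (itime e + itime ea + itime i + itime j + dev_time p q).+1.

(* Input/output conventions.  Memory cells not mentioned hold arbitrary values:
   working memory is not assumed to be initialised. *)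

Definition projection_input (nS nA : nat) (a : 'I_nA) (pbar b : 'rV[R]_nS)
    (beta : R) (st : state) : Prop :=
  [/\ ivar st 0 = nS, ivar st 1 = nA & ivar st 2 = a] /\
  [/\ (forall i : 'I_nS, rarr st 0 i = b 0 i),
      (forall i : 'I_nS, rarr st 1 i = pbar 0 i)
    & rarr st 2 0 = beta].

(* Integer variable 3 flags whether the value is finite. *)
Definition projection_output (st : state) : \bar R :=
  if ivar st 3 == 0%N then +oo%E else (rarr st 3 0)%:E.

Definition bellman_input (nS nA : nat) (r pbar : 'I_nS -> 'I_nA -> 'rV[R]_nS)
    (lambda kappa eps : R) (v : 'rV[R]_nS) (st : state) : Prop :=
  [/\ ivar st 0 = nS & ivar st 1 = nA] /\
  [/\ (forall (s : 'I_nS) (a : 'I_nA) (s' : 'I_nS),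
         rarr st 0 ((s * nA + a) * nS + s') = r s a 0 s'),
      (forall (s : 'I_nS) (a : 'I_nA) (s' : 'I_nS),
         rarr st 1 ((s * nA + a) * nS + s') = pbar s a 0 s')
    & (forall s : 'I_nS, rarr st 2 s = v 0 s)] /\
  [/\ rarr st 3 0 = lambda, rarr st 4 0 = kappa & rarr st 5 0 = eps].

Definition bellman_output (nS : nat) (st : state) : 'rV[R]_nS := slice nS st 6 0.

(* The projections are computed exactly in time O(h(S)): a single program and a
   single constant serve all sizes, actions and inputs. *)
Definition projection_computable (d : forall nS nA : nat, deviations R nS nA)
    (h : nat -> R) : Prop :=
  exists (Q : cmd) (c : R), 0 < c /\
    forall (nS nA : nat) (a : 'I_nA) (pbar b : 'rV[R]_nS) (beta : R)
           (st : state),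
      (0 < nS)%N -> simplex pbar -> (forall i, 0 <= b 0 i) -> 0 <= beta ->
      projection_input a pbar b beta st ->
      exists (st' : state) (k : nat),
        [/\ exec (d nS nA) Q st st' k,
            projection_output st' = projection (d nS nA) a pbar b beta
          & k%:R <= c * h nS].

End Semantics.

(* Main.v *)
Require Import Defs.
From mathcomp Require Import all_boot all_order all_algebra.
From mathcomp Require Import all_classical all_reals.
From mathcomp Require Import ereal normedtype exp.
From mathcomp Require Import zify ring lra.
Import Order.TTheory GRing.Theory Num.Theory.
Local Open Scope ring_scope.

(** Fix a state [s] and write [b_a = r_sa + lambda v].  The Bellman value at
    [s] is the value of a game in which the decision maker mixes the actions
    and nature picks transition probabilities in a convex ambiguity set.  The
    payoff is affine in nature's choice, so a minimax argument
    ([convexlike_alternative]) lets nature move first: the value is the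
    infimum over the ambiguity set of the largest [b_a^T p_a].  Hence the
    value is at most [theta] when nature can afford to bring every [b_a^T p_a]
    down to [theta].  For a fixed [theta] the actions only interact through
    the budget, and the cheapest way to treat action [a] costs exactly the
    projection with bound [theta]; so it suffices to compare the sum over [a]
    of the projections with [kappa].  Since infima need not be attained, this
    is stated as two implications, [game_value_le_feasible] and
    [le_game_value_infeasible], both with a weak inequality on the value:
    exactly what a bisection needs.

    The value lies in [[0, Rbar]], so bisection reaches accuracy [eps] after
    about [log2 (Rbar / eps)] rounds ([exists_halvings]), each of them calling
    the projection program once per action.

    The time bound has a hidden point: before every call one must write the
    [S] entries of [b_a] and of the nominal distribution, and this has to be
    paid from [h S].  It can, because [h] is at least linear
    ([projection_time_ge]): a program that leaves an entry of [b] unread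
    cannot tell whether the projection is feasible.

    The projection program may overwrite every memory name that occurs in it.
    The Bellman program therefore works with names beyond all of these: it
    copies its input there at the start and moves its result to the output
    array at the end.  Correctness and time are derived together, with the
    weakest precondition rules for [wp]; what a command leaves alone is read
    off its text ([exec_frame]). *)

(** * A minimax theorem for finitely many convex payoffs *)

Section Alternative.
Local Open Scope classical_set_scope.
Variable R : realType.

(** The weights [t] that work at a point where [f] is negative lie below a
    bound, those that work where [g] is negative lie above one.  The two kinds
    of bounds are compatible: otherwise a point of the segment between two
    conflicting points would make both functions negative. *)
Lemma convexlike_alternative2 (T : Type) (X : set T) (f g : T -> R) :
  (forall x y t, X x -> X y -> 0 <= t <= 1 -> exists2 z, X z &
     f z <= t * f x + (1 - t) * f y /\ g z <= t * g x + (1 - t) * g y) ->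
  (forall x, X x -> 0 <= f x \/ 0 <= g x) ->
  exists2 t, 0 <= t <= 1 & forall x, X x -> 0 <= t * f x + (1 - t) * g x.
Proof.
move=> cvx pos.
pose lower := [set - g y / (f y - g y) | y in [set y | X y /\ g y < 0]].
pose E := [set 0] `|` lower.
have posl y : X y -> g y < 0 -> 0 <= f y.
  by move=> /pos[//|?] ?; lra.
have E0 : E 0 by left.
have ubE u : 0 <= u ->
    (forall y, X y -> g y < 0 -> - g y <= u * (f y - g y)) -> ubound E u.
  move=> u0 hu _ [->//|[y [Xy gy] <-]].
  by rewrite ler_pdivrMr ?hu //; have := posl _ Xy gy; lra.
have ub1 : ubound E 1.
  by apply: ubE => // y Xy gy; rewrite mul1r; have := posl _ Xy gy; lra.
have hasE : has_sup E by split; [exists 0 | exists 1].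
have t0 : 0 <= sup E by exact: ub_le_sup hasE.2 _ E0.
have t1 : sup E <= 1 by apply: ge_sup => //; exists 0.
exists (sup E) => [|x Xx]; first by rewrite t0 t1.
have [gx|gx] := ltP (g x) 0.
  have fx := posl _ Xx gx.
  have : - g x / (f x - g x) <= sup E.
    by apply: ub_le_sup hasE.2 _ _; right; exists x.
  by rewrite ler_pdivrMr; lra.
have [fx|fx] := ltP (f x) 0; last first.
  by rewrite addr_ge0 // mulr_ge0 // subr_ge0.
suff : sup E <= g x / (g x - f x) by rewrite ler_pdivlMr; lra.
apply: ge_sup; first by exists 0.
apply: ubE => [|y Xy gy]; first by rewrite divr_ge0 //; lra.
rewrite mulrAC ler_pdivlMr; last lra.
have fy := posl _ Xy gy.
suff : g y * f x <= g x * f y by lra.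
(* Otherwise some point of the segment from [x] to [y] makes both negative;
   [t] solves t (f x - g x) + (1 - t) (f y - g y) = 0. *)
rewrite leNgt; apply/negP => lt.
pose D := f y - g y + (g x - f x).
have D0 : 0 < D by rewrite /D; lra.
pose t := (f y - g y) / D.
have tD : t * D = f y - g y by rewrite /t divfK // gt_eqF.
have t01 : 0 <= t <= 1.
  by rewrite /t divr_ge0 ?ler_pdivrMr //= /D; lra.
have [z Xz [fz gz]] := cvx x y t Xx Xy t01.
have fz0 : f z < 0.
  apply: le_lt_trans fz _; rewrite -(pmulr_rlt0 _ D0).
  have -> : D * (t * f x + (1 - t) * f y)
    = (t * D) * f x + (D - t * D) * f y by ring.
  rewrite tD /D; nra.
have gz0 : g z < 0.
  apply: le_lt_trans gz _; rewrite -(pmulr_rlt0 _ D0).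
  have -> : D * (t * g x + (1 - t) * g y)
    = (t * D) * g x + (D - t * D) * g y by ring.
  rewrite tD /D; nra.
by have [] := pos z Xz; lra.
Qed.

(** Only convex-likeness is assumed, so that the induction on the number of
    functions can restrict [X] to the points where the last function is
    negative: a combination of the others that is non-negative there is then
    paired with the last function. *)
Lemma convexlike_alternative (T : Type) n (X : set T) (f : 'I_n.+1 -> T -> R) :
  (forall x y t, X x -> X y -> 0 <= t <= 1 -> exists2 z, X z &
     forall a, f a z <= t * f a x + (1 - t) * f a y) ->
  (forall x, X x -> exists a, 0 <= f a x) ->
  exists2 w : 'rV[R]_n.+1, simplex w &
    forall x, X x -> 0 <= \sum_a w 0 a * f a x.
Proof.
elim: n X f => [|n IH] X f cvx pos.
  exists (const_mx 1) => [|x Xx].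
    by split=> [i|]; rewrite ?mxE ?big_ord1 ?mxE.
  rewrite big_ord1 mxE mul1r; have [a] := pos x Xx.
  by rewrite (ord1 a).
have wE i : widen_ord (leqnSn n.+1) i = lift ord_max i.
  by apply: val_inj; rewrite /= /bump leqNgt ltn_ord.
pose g := f ord_max.
pose X' := [set x | X x /\ g x < 0].
pose f' (i : 'I_n.+1) := f (widen_ord (leqnSn _) i).
have [||w sw hw] := IH X' f'.
- move=> x y t [Xx gx] [Xy gy] t01.
  have [z Xz hz] := cvx x y t Xx Xy t01; exists z => // [|a]; last exact: hz.
  split=> //; apply: le_lt_trans (hz _) _; case/andP: t01 => t0 t1.
  by rewrite -/(g x) -/(g y) -/g; nra.
- move=> x [Xx gx]; have [a ha] := pos x Xx.
  case: (unliftP ord_max a) ha => [j ->|->] ha; last first.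
    by have := le_lt_trans ha gx; rewrite ltxx.
  by exists j; rewrite /f' wE.
have [sw0 _] := sw.
pose F x := \sum_a w 0 a * f' a x.
have [||t t01 ht] := convexlike_alternative2 T X F g.
- move=> x y t Xx Xy t01.
  have [z Xz hz] := cvx x y t Xx Xy t01; exists z => //; split; last exact: hz.
  rewrite /F !mulr_sumr -big_split /=; apply: ler_sum => a _.
  have := ler_wpM2l (sw0 a) (hz (widen_ord (leqnSn _) a)).
  by rewrite -/(f' a); lra.
- move=> x Xx; have [gx|gx] := ltP (g x) 0; last by right.
  by left; exact: hw.
case/andP: t01 => t0 t1; have [w0 w1] := sw.
exists (\row_i if unlift ord_max i is Some j then t * w 0 j else 1 - t).
  split=> [i|].
    rewrite mxE; case: unliftP => [j _|_]; last by rewrite subr_ge0.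
    by rewrite mulr_ge0 // w0.
  rewrite big_ord_recr /= mxE unlift_none.
  under eq_bigr do rewrite mxE wE liftK.
  by rewrite -mulr_sumr w1; ring.
move=> x Xx; rewrite big_ord_recr /= mxE unlift_none.
under eq_bigr do rewrite mxE {1}wE liftK -mulrA.
by rewrite -mulr_sumr; exact: ht.
Qed.
End Alternative.


(** * The Bellman value and the budget for the projections *)

Lemma simplex_delta (R : realType) n (i : 'I_n) : simplex (delta_mx 0 i : 'rV[R]_n).
Proof.
split=> [j|]; first by rewrite mxE eqxx /=; case: (j == i).
rewrite (bigD1 i) //= mxE !eqxx /= big1 ?addr0 // => j /negbTE ji.
by rewrite mxE ji.
Qed.

Section Value.
Local Open Scope classical_set_scope.
Variables (R : realType) (nS nA : nat) (d : deviations R nS nA).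
Hypothesis hd : deviation_axioms d.
Variables (pbar b : 'I_nA -> 'rV[R]_nS) (kappa top : R).
Hypothesis nA_gt0 : (0 < nA)%N.
Hypothesis hpbar : forall a, simplex (pbar a).
Hypothesis kappa_gt0 : 0 < kappa.
Hypothesis hb : forall a i, 0 <= b a 0 i <= top.

Definition payoff (w : 'rV[R]_nA) (p : 'I_nA -> 'rV[R]_nS) : R :=
  \sum_a w 0 a * dot (p a) (b a).

(** One entry of the Bellman iterate, with the target rewards [b a] abstracted
    from the instance. *)
Definition game_value : R :=
  sup [set inf [set payoff w p | p in ambiguity d pbar kappa]
      | w in @simplex R nA].

Lemma dotC (x y : 'rV[R]_nS) : dot x y = dot y x.
Proof. by apply: eq_bigr => i _; rewrite mulrC. Qed.

Lemma dot_mix t (x y z : 'rV[R]_nS) :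
  dot (t *: x + (1 - t) *: y) z = t * dot x z + (1 - t) * dot y z.
Proof.
rewrite /dot !mulr_sumr -big_split /=; apply: eq_bigr => i _.
by rewrite !mxE; ring.
Qed.

Lemma simplex_mix t (x y : 'rV[R]_nS) : 0 <= t <= 1 ->
  simplex x -> simplex y -> simplex (t *: x + (1 - t) *: y).
Proof.
move=> /andP[t0 t1] [x0 x1] [y0 y1]; split=> [i|].
  by rewrite !mxE addr_ge0 // mulr_ge0 // subr_ge0.
under eq_bigr do rewrite !mxE.
by rewrite big_split /= -!mulr_sumr x1 y1; ring.
Qed.

Lemma dot_ge0 a p : simplex p -> 0 <= dot p (b a).
Proof.
move=> [p0 _]; apply: sumr_ge0 => i _.
by rewrite mulr_ge0 //; case/andP: (hb a i).
Qed.

Lemma dot_le a p : simplex p -> dot p (b a) <= top.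
Proof.
move=> [p0 p1]; rewrite -[leRHS]mul1r -p1 mulr_suml; apply: ler_sum => i _.
by rewrite ler_wpM2l //; case/andP: (hb a i).
Qed.

Lemma payoff_ge0 w p : simplex w -> (forall a, simplex (p a)) ->
  0 <= payoff w p.
Proof.
move=> [w0 _] sp; apply: sumr_ge0 => a _.
by rewrite mulr_ge0 // dot_ge0.
Qed.

Lemma payoff_le w p c : simplex w -> (forall a, dot (p a) (b a) <= c) ->
  payoff w p <= c.
Proof.
move=> [w0 w1] sp; rewrite -[leRHS]mul1r -w1 mulr_suml.
by apply: ler_sum => a _; rewrite ler_wpM2l.
Qed.

Lemma ambiguity_pbar : ambiguity d pbar kappa pbar.
Proof.
split=> //; rewrite big1 ?(ltW kappa_gt0) // => a _.
by have [_ _ ->] := hd a (pbar a) (hpbar a).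
Qed.

Lemma inf_payoff_le w p : simplex w -> ambiguity d pbar kappa p ->
  inf [set payoff w p | p in ambiguity d pbar kappa] <= payoff w p.
Proof.
move=> sw hp; apply: ge_inf; last by exists p.
by exists 0 => _ [q [hq _] <-]; exact: payoff_ge0.
Qed.

Lemma game_value_le c :
  (forall w, simplex w ->
     inf [set payoff w p | p in ambiguity d pbar kappa] <= c) ->
  game_value <= c.
Proof.
move=> H; apply: ge_sup; last by move=> _ [w sw <-]; exact: H.
by eexists; exists (delta_mx 0 (Ordinal nA_gt0)) => //; exact: simplex_delta.
Qed.

(** The bound [top] on the targets is what makes the supremum a genuine one. *)
Lemma le_game_value c w : simplex w ->
  (forall p, ambiguity d pbar kappa p -> c <= payoff w p) ->
  c <= game_value.
Proof.
move=> sw H.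
have : c <= inf [set payoff w p | p in ambiguity d pbar kappa].
  apply: lb_le_inf; last by move=> _ [p hp <-]; exact: H.
  by eexists; exists pbar => //; exact: ambiguity_pbar.
move=> /le_trans; apply; apply: ub_le_sup; last by exists w.
exists top => _ [u su <-].
apply: le_trans (inf_payoff_le _ _ su ambiguity_pbar) _.
by apply: payoff_le => // a; exact: dot_le.
Qed.

Lemma game_value_bounds : 0 <= game_value <= top.
Proof.
apply/andP; split.
  apply: (le_game_value _ (delta_mx 0 (Ordinal nA_gt0))).
    exact: simplex_delta.
  by move=> p [sp _]; apply: payoff_ge0 => //; exact: simplex_delta.
apply: game_value_le => w sw.
apply: le_trans (inf_payoff_le _ _ sw ambiguity_pbar) _.
by apply: payoff_le => // a; exact: dot_le.
Qed.

Lemma projection_ge0 a theta : (0 <= projection d a (pbar a) (b a) theta)%E.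
Proof.
apply: le_ereal_inf_tmp => _ [p [_ sp] <-]; rewrite lee_fin.
by have [_ h _] := hd a (pbar a) (hpbar a); exact: h.
Qed.

(** When the projections fit the budget, nature has choices that almost do so
    and keep all payoffs below [theta]; convexity of the deviations turns them
    into admissible ones with payoffs arbitrarily close to [theta]. *)
Lemma game_value_le_feasible theta :
  (\sum_a projection d a (pbar a) (b a) theta <= kappa%:E)%E ->
  game_value <= theta.
Proof.
move=> hsum; apply: game_value_le => w sw.
have fin a : projection d a (pbar a) (b a) theta \is a fin_num.
  rewrite ge0_fin_numE ?projection_ge0 //.
  apply: le_lt_trans (ltry kappa); apply: le_trans hsum.
  rewrite (bigD1 a) //= leeDl // sume_ge0 // => i _; exact: projection_ge0.
pose x a := fine (projection d a (pbar a) (b a) theta).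
have hx : \sum_a x a <= kappa.
  rewrite -lee_fin; apply: le_trans hsum; rewrite -sumEFin.
  by rewrite lee_sum // => a _; rewrite fineK.
(* Near-optimal points may overshoot the budget; moving them towards [pbar]
   restores it, and raises the payoffs by a multiple of [t] only. *)
have approx t : 0 < t <= 1 ->
    inf [set payoff w p | p in ambiguity d pbar kappa] <= theta + t * (`|top| + `|theta|).
  move=> /andP[t0 t1].
  pose dl := t * kappa / nA%:R.
  have nA0 : 0 < nA%:R :> R by rewrite ltr0n.
  have dl0 : 0 < dl by rewrite divr_gt0 // mulr_gt0.
  have near a : exists p, [/\ dot (b a) p <= theta, simplex p
      & d a p (pbar a) < x a + dl].
    have : (projection d a (pbar a) (b a) theta < (x a + dl)%:E)%E.
      by rewrite -[X in (X < _)%E]fineK // lte_fin /x ltrDl.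
    by move=> /ereal_inf_lt[_ [p [h1 h2] <-]]; rewrite lte_fin => h3; exists p.
  have [p hp] := choice near.
  pose p' a := t *: pbar a + (1 - t) *: p a.
  have t01 : 0 <= t <= 1 by rewrite ltW.
  have sp' a : simplex (p' a) by apply: simplex_mix => //; case: (hp a).
  have dp' a : d a (p' a) (pbar a) <= (1 - t) * (x a + dl).
    have [cv _ z] := hd a (pbar a) (hpbar a); have [_ sp lt] := hp a.
    apply: le_trans (cv _ _ _ (hpbar a) sp t01) _.
    rewrite (z _ (hpbar a)).2 // mulr0 add0r.
    by rewrite ler_wpM2l ?subr_ge0 // ltW.
  apply: (le_trans (inf_payoff_le w p' sw _)).
    split=> //; apply: le_trans (ler_sum _ (fun a _ => dp' a)) _.
    rewrite -mulr_sumr big_split /= sumr_const card_ord -mulr_natr /dl.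
    rewrite divfK ?gt_eqF //.
    have u0 : 0 <= 1 - t by rewrite subr_ge0.
    have := ler_wpM2l u0 hx; rewrite mulrDr.
    have : 0 <= t * (t * kappa) by rewrite !mulr_ge0 // ltW.
    lra.
  apply: payoff_le => // a; rewrite dot_mix.
  have [h1 sp _] := hp a; rewrite dotC in h1.
  have h2 := dot_le a _ (hpbar a).
  have ht := ler_norm top; have hn := ler_norm (- theta).
  rewrite normrN in hn; nra.
have [lt0|//] := ltP theta
  (inf [set payoff w p | p in ambiguity d pbar kappa]).
set I := inf _ in lt0 approx *.
pose B := `|top| + `|theta|.
have B0 : 0 <= B by rewrite addr_ge0.
pose t := Num.min 1 ((I - theta) / (B + 1) / 2).
have t0 : 0 < t.
  rewrite /t lt_min ltr01 /= !divr_gt0 //; last lra; by rewrite subr_gt0.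
have t1 : t <= 1 by rewrite /t ge_min lexx.
have := approx t; rewrite t0 t1 -/B => /(_ isT).
have : t * (B + 1) <= (I - theta) / 2.
  rewrite -ler_pdivlMr; last lra.
  by rewrite mulrAC /t ge_min lexx orbT.
nra.
Qed.

(** When the projections exceed the budget, every admissible choice of nature
    leaves some action with payoff at least [theta]; by the minimax theorem a
    single mixed action then secures [theta] against all choices. *)
Lemma le_game_value_infeasible theta :
  (kappa%:E < \sum_a projection d a (pbar a) (b a) theta)%E ->
  theta <= game_value.
Proof.
move=> hsum.
have infeas p : ambiguity d pbar kappa p ->
    exists a, 0 <= dot (p a) (b a) - theta.
  move=> [sp hp]; apply/not_existsP => H.
  move: hsum; rewrite ltNge => /negP; apply.
  apply: (@le_trans _ _ (\sum_a (d a (p a) (pbar a))%:E)%E); last first.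
    by rewrite sumEFin lee_fin.
  apply: lee_sum => a _; apply: ereal_inf_lbound.
  exists (p a) => //; split => //; rewrite dotC.
  by have /negP := H a; rewrite -ltNge; lra.
have [w sw hw] : exists2 w : 'rV[R]_nA, simplex w &
    forall p, ambiguity d pbar kappa p ->
      0 <= \sum_a w 0 a * (dot (p a) (b a) - theta).
  move: nA_gt0 infeas; rewrite /payoff.
  case: (nA) d hd pbar hpbar b => // n d' hd' pb hpb b' _ infeas.
  apply: (convexlike_alternative R _ n (ambiguity d' pb kappa)
    (fun a p => dot (p a) (b' a) - theta)) => //.
  move=> p q t [sp hp] [sq hq] t01.
  exists (fun a => t *: p a + (1 - t) *: q a); last first.
    by move=> a; rewrite dot_mix; lra.
  split=> [a|]; first exact: simplex_mix.
  apply: (@le_trans _ _ (\sum_a (t * d' a (p a) (pb a)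
                                 + (1 - t) * d' a (q a) (pb a)))).
    apply: ler_sum => a _; have [cv _ _] := hd' a (pb a) (hpb a).
    exact: cv.
  rewrite big_split /= -!mulr_sumr; case/andP: t01 => t0 t1; nra.
apply: (le_game_value _ w) => // p hp.
have := hw p hp; under eq_bigr do rewrite mulrBr.
have [_ w1] := sw.
rewrite sumrB -mulr_suml w1 mul1r subr_ge0; exact.
Qed.
End Value.

(** * Computing projections takes at least linear time *)

Section Adversary.
Local Open Scope classical_set_scope.
Variable R : realType.
Implicit Types st : state R.

Lemma state_eqP st st' :
  ivar st = ivar st' -> rarr st = rarr st' -> st = st'.
Proof. by case: st st' => [i r] [i' r'] /= -> ->. Qed.

Lemma exec_deterministic nS nA (d : deviations R nS nA) c st st1 k1 :
  exec d c st st1 k1 ->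
  forall st2 k2, exec d c st st2 k2 -> st1 = st2.
Proof.
elim=> {c st st1 k1}.
- by move=> st st2 k2 H; inversion H.
- move=> c1 c2 st st1 st2 k1 k2 _ IH1 _ IH2 st3 k3 H.
  inversion H; subst.
  match goal with H1 : exec d c1 st _ _, H2 : exec d c2 _ st3 _ |- _ =>
    rewrite -(IH1 _ _ H1) in H2; exact: IH2 H2 end.
- move=> b c1 c2 st st' k hb _ IH st2 k2 H.
  inversion H; subst; first by eapply IH; eassumption.
  by match goal with Hn : is_true (~~ _) |- _ => rewrite hb in Hn end.
- move=> b c1 c2 st st' k hb _ IH st2 k2 H.
  inversion H; subst; last by eapply IH; eassumption.
  by match goal with Hn : is_true (beval _ _) |- _ => rewrite Hn in hb end.
- move=> b c st st1 st2 k1 k2 hb _ IH1 _ IH2 st3 k3 H.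
  inversion H; subst; last first.
    by match goal with Hn : is_true (~~ _) |- _ => rewrite hb in Hn end.
  match goal with H1 : exec d c st _ _, H2 : exec d (CWhile b c) _ st3 _ |- _ =>
    rewrite -(IH1 _ _ H1) in H2; exact: IH2 H2 end.
- move=> b c st hb st2 k2 H.
  inversion H; subst => //.
  by match goal with Hn : is_true (beval _ _) |- _ => rewrite Hn in hb end.
- by move=> x e st st2 k2 H; inversion H.
- by move=> x e f st st2 k2 H; inversion H.
- move=> x e ea y i z j st a p q ha -> -> _ _ st2 k2 H.
  inversion H; subst.
  match goal with Ha : ieval st ea = nat_of_ord ?a0 |- _ =>
    have -> // : a = a0 by apply: val_inj; rewrite /= -ha -Ha end.
Qed.

Lemma set_rarrC st x i y j (w u : R) :
  (x, i) != (y, j) ->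
  set_rarr (set_rarr st x i w) y j u = set_rarr (set_rarr st y j u) x i w.
Proof.
move=> ne; apply: state_eqP => //=; apply/funext => z; apply/funext => l /=.
case: (boolP ((z == y) && (l == j))) => [/andP[/eqP-> /eqP->]|//].
by case: ifP => // /andP[/eqP ? /eqP ?]; subst; rewrite eqxx in ne.
Qed.

(** Only the array 0, which holds the vector [b], is tracked. *)
Fixpoint reads st (e : rexp) : seq nat :=
  match e with
  | RNat _ => [::]
  | RGet x e1 => if x == 0%N then [:: ieval st e1] else [::]
  | RAdd e1 e2 | RSub e1 e2 | RMul e1 e2 | RDiv e1 e2 =>
      reads st e1 ++ reads st e2
  end.

Fixpoint breads st (b : bexp) : seq nat :=
  match b with
  | BLeI _ _ => [::]
  | BLeR e1 e2 => reads st e1 ++ reads st e2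
  | BNot b1 => breads st b1
  end.

Lemma size_reads st e : (size (reads st e) <= rtime e)%N.
Proof.
elim: e => [e|x e|e1 I1 e2 I2|e1 I1 e2 I2|e1 I1 e2 I2|e1 I1 e2 I2] //=;
  rewrite ?size_cat; try lia.
by case: ifP => //=; lia.
Qed.

Lemma size_breads st b : (size (breads st b) <= btime b)%N.
Proof.
elim: b => [e1 e2|e1 e2|b I] //=; last lia.
rewrite size_cat; have := size_reads st e1; have := size_reads st e2; lia.
Qed.

Lemma ieval_set_rarr st x i w e : ieval (set_rarr st x i w) e = ieval st e.
Proof. by elim: e => //= e1 -> e2 ->. Qed.

Lemma reval_unread st i w e :
  i \notin reads st e -> reval (set_rarr st 0 i w) e = reval st e.
Proof.
elim: e => [e|x e|e1 I1 e2 I2|e1 I1 e2 I2|e1 I1 e2 I2|e1 I1 e2 I2] /=;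
  rewrite ?ieval_set_rarr //;
  try by rewrite mem_cat negb_or => /andP[/I1-> /I2->].
by case: eqP => //= _; rewrite inE eq_sym => /negbTE->.
Qed.

Lemma beval_unread st i w b :
  i \notin breads st b -> beval (set_rarr st 0 i w) b = beval st b.
Proof.
elim: b => [e1 e2|e1 e2|b I] /=; rewrite ?ieval_set_rarr //.
  by rewrite mem_cat negb_or => /andP[h1 h2]; rewrite !reval_unread.
by move=> /I->.
Qed.

(** A deviation query reads a whole slice at unit cost if the slice is a Dirac
    distribution.  The value 2 protects a cell from this: it does not occur in
    a probability vector, so an unmodified cell is in no admissible slice. *)
Lemma slice_no2 n st y i l w :
  simplex (slice n st y i) -> rarr st 0 l = 2 ->
  slice n (set_rarr st 0 l w) y i = slice n st y i.
Proof.
move=> [ge0 sum1] l2; apply/rowP => j; rewrite !mxE /=.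
case: ifP => // /andP[/eqP y0 /eqP il]; move: ge0 sum1; rewrite y0 => ge0 sum1.
have : 2 <= \sum_i0 slice n st 0 i 0 i0.
  rewrite (bigD1 j) //= {1}mxE il l2 lerDl.
  by apply: sumr_ge0 => k _; exact: ge0.
by rewrite sum1; lra.
Qed.

(** The list [L] collects the cells of array 0 that are read or overwritten,
    each of which costs one unit of time; the run is insensitive to the others. *)
Lemma exec_unread nS nA (d : deviations R nS nA) c st st1 k :
  exec d c st st1 k ->
  exists2 L : seq nat, (size L <= k)%N &
    forall l w, l \notin L -> rarr st 0 l = 2 ->
      rarr st1 0 l = 2 /\ exec d c (set_rarr st 0 l w) (set_rarr st1 0 l w) k.
Proof.
elim=> {c st st1 k}.
- by move=> st; exists [::] => // l w _ l2; split => //; constructor.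
- move=> c1 c2 st st1 st2 k1 k2 _ [L1 s1 H1] _ [L2 s2 H2].
  exists (L1 ++ L2); first by rewrite size_cat; lia.
  move=> l w; rewrite mem_cat negb_or => /andP[n1 n2] l2.
  have [l2' e1] := H1 l w n1 l2; have [l2'' e2] := H2 l w n2 l2'.
  by split => //; econstructor; eassumption.
- move=> b c1 c2 st st' k hb _ [L s H].
  exists (breads st b ++ L).
    by rewrite size_cat; have := size_breads st b; lia.
  move=> l w; rewrite mem_cat negb_or => /andP[n1 n2] l2.
  have [l2' e] := H l w n2 l2; split => //; apply: ExecIfT => //.
  by rewrite beval_unread.
- move=> b c1 c2 st st' k hb _ [L s H].
  exists (breads st b ++ L).
    by rewrite size_cat; have := size_breads st b; lia.
  move=> l w; rewrite mem_cat negb_or => /andP[n1 n2] l2.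
  have [l2' e] := H l w n2 l2; split => //; apply: ExecIfF => //.
  by rewrite beval_unread.
- move=> b c st st1 st2 k1 k2 hb _ [L1 s1 H1] _ [L2 s2 H2].
  exists (breads st b ++ L1 ++ L2).
    by rewrite !size_cat; have := size_breads st b; lia.
  move=> l w; rewrite !mem_cat !negb_or => /and3P[n0 n1 n2] l2.
  have [l2' e1] := H1 l w n1 l2; have [l2'' e2] := H2 l w n2 l2'.
  by split => //; econstructor; [rewrite beval_unread|eassumption..].
- move=> b c st hb; exists (breads st b); first exact: size_breads.
  move=> l w n0 l2; split => //; apply: ExecWhileF.
  by rewrite beval_unread.
- move=> x e st; exists [::] => // l w _ l2; split => //.
  by rewrite -[ieval st e](ieval_set_rarr st 0 l w); exact: ExecSetI.
- move=> x e f st; exists (ieval st e :: reads st f).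
    by rewrite /=; have := size_reads st f; lia.
  move=> l w; rewrite inE negb_or => /andP[n1 n2] l2.
  split; first by rewrite /= (negbTE n1) andbF.
  rewrite -set_rarrC; last by rewrite xpair_eqE negb_and eq_sym n1 orbT.
  rewrite -[ieval st e](ieval_set_rarr st 0 l w) -(reval_unread st l w f n2).
  exact: ExecSetR.
- move=> x e ea y i z j st a p q ha hp hq sp sq.
  exists [:: ieval st e]; first by rewrite /=; lia.
  move=> l w; rewrite inE => n1 l2.
  split; first by rewrite /= (negbTE n1) andbF.
  rewrite -set_rarrC; last by rewrite xpair_eqE negb_and eq_sym n1 orbT.
  rewrite -[ieval st e](ieval_set_rarr st 0 l w).
  by apply: ExecDev => //; rewrite ieval_set_rarr // slice_no2 // -?hp -?hq.
Qed.

(** For [b] constantly 2 and bound 0 the projection is infeasible.  A run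
    shorter than [nS] misses some entry of [b]; changing this entry to 0 makes
    the projection feasible, yet the run ends with the same answer. *)
Lemma projection_time_ge (d : forall nS nA : nat, deviations R nS nA)
    (Q : cmd) nS (tm : R) :
  (0 < nS)%N ->
  (forall (a : 'I_1) (pbar b : 'rV[R]_nS) (beta : R) st,
      simplex pbar -> (forall i, 0 <= b 0 i) -> 0 <= beta ->
      projection_input a pbar b beta st ->
      exists (st' : state R) (k : nat),
        [/\ exec (d nS 1) Q st st' k,
            projection_output st' = projection (d nS 1) a pbar b beta
          & k%:R <= tm]) ->
  nS%:R <= tm.
Proof.
case: nS => // n _ hQ.
pose pb : 'rV[R]_n.+1 := delta_mx 0 0.
have spb : simplex pb by exact: simplex_delta.
pose b : 'rV[R]_n.+1 := const_mx 2.
pose st := @State R (fun x => if x == 0 then n.+1 else if x == 1 then 1 else 0)%N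
  (fun y i => if y == 0%N then 2 else if y == 1%N then
      (if i == 0%N then 1 else 0) else 0).
have [||||st1 [k [ex out lek]]] := hQ 0 pb b 0 st => //.
- by move=> i; rewrite mxE.
- by split; split => //= i; rewrite !mxE //= -val_eqE /=; case: eqP.
apply: le_trans lek; rewrite ler_nat leqNgt; apply/negP => ltk.
have dot_ge0 (p : 'rV[R]_n.+1) : simplex p -> dot b p = 2.
  move=> [_ s1]; transitivity (2 * \sum_i p 0 i); last by rewrite s1 mulr1.
  by rewrite mulr_sumr; apply: eq_bigr => i _; rewrite mxE.
have projoo : projection (d n.+1 1) 0 pb b 0 = +oo%E.
  rewrite /projection (_ : [set p | _] = set0) ?image_set0 ?ereal_inf0 //.
  by apply/seteqP; split => // p /= [] /[swap] /dot_ge0 ->; lra.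
have [L sL hL] := exec_unread _ _ _ _ _ _ _ ex.
have [l ln lL] : exists2 l : 'I_n.+1, true & nat_of_ord l \notin L.
  apply/exists_inP; apply: contraTT (ltk); rewrite negb_exists_in => /forall_inP h.
  rewrite -leqNgt; apply: leq_trans sL.
  have := @uniq_leq_size _ (map val (enum 'I_n.+1)) L.
  rewrite val_enum_ord iota_uniq size_iota; apply => //.
  move=> x; rewrite mem_iota add0n => /andP[_ ltx].
  by have := h (Ordinal ltx) isT; rewrite negbK.
have [//|_ ex'] := hL _ 0 lL.
pose b' : 'rV[R]_n.+1 := \row_i if i == l then 0 else 2.
have [||||st2 [k2 [ex2 out2 _]]] := hQ 0 pb b' 0 (set_rarr st 0 l 0) => //.
- by move=> i; rewrite mxE; case: ifP.
- split; split => //= i; rewrite !mxE //=.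
  by rewrite -val_eqE /=; case: eqP.
have e12 := exec_deterministic _ _ _ _ _ _ _ ex' _ _ ex2.
have outE : projection_output st2 = projection_output st1.
  rewrite -e12 /projection_output /=.
  move: out; rewrite projoo /projection_output; case: ifP => //.
have : (projection (d n.+1 1%N) 0%R pb b' 0%R <= (d n.+1 1%N 0%R (delta_mx 0%R l) pb)%:E)%E.
  apply: ereal_inf_lbound; exists (delta_mx 0 l) => //; split; last exact: simplex_delta.
  rewrite /dot (bigD1 l) //= big1 ?addr0 ?mxE ?eqxx ?mul0r //.
  by move=> i /negbTE il; rewrite !mxE il mulr0.
by rewrite -out2 outE out projoo.
Qed.
End Adversary.

(** * Weakest preconditions with running time *)

Fixpoint iwrites (c : cmd) : seq nat :=
  match c with
  | CSkip | CSetR _ _ _ | CDev _ _ _ _ _ _ _ => [::]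
  | CSeq c1 c2 | CIf _ c1 c2 => iwrites c1 ++ iwrites c2
  | CWhile _ c1 => iwrites c1
  | CSetI x _ => [:: x]
  end.

Fixpoint rwrites (c : cmd) : seq nat :=
  match c with
  | CSkip | CSetI _ _ => [::]
  | CSeq c1 c2 | CIf _ c1 c2 => rwrites c1 ++ rwrites c2
  | CWhile _ c1 => rwrites c1
  | CSetR x _ _ | CDev x _ _ _ _ _ _ => [:: x]
  end.

Section Logic.
Variables (R : realType) (nS nA : nat) (d : deviations R nS nA).
Implicit Types st : state R.

(** [frame c st st'] is what the text of [c] alone says about its runs. *)
Definition frame c st st' :=
  (forall x, x \notin iwrites c -> ivar st' x = ivar st x) /\
  (forall y, y \notin rwrites c -> rarr st' y = rarr st y).

Lemma frame_trans c st1 st2 st3 :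
  frame c st1 st2 -> frame c st2 st3 -> frame c st1 st3.
Proof.
move=> [i1 r1] [i2 r2].
by split=> [x hx|y hy]; [rewrite i2 ?i1|rewrite r2 ?r1].
Qed.

Lemma frame_sub c c' st st' :
  {subset iwrites c <= iwrites c'} -> {subset rwrites c <= rwrites c'} ->
  frame c st st' -> frame c' st st'.
Proof.
move=> si sr [hi hr]; split=> x hx; [apply: hi | apply: hr];
  by apply: contra hx; first [exact: si | exact: sr].
Qed.

Lemma exec_frame c st st' k : exec d c st st' k -> frame c st st'.
Proof.
elim=> {c st st' k} //.
- move=> c1 c2 st st1 st2 k1 k2 _ h1 _ h2; apply: (frame_trans _ _ st1).
    by apply: frame_sub h1 => x hx /=; rewrite mem_cat hx.
  by apply: frame_sub h2 => x hx /=; rewrite mem_cat hx orbT.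
- move=> b c1 c2 st st' k _ _ h.
  by apply: frame_sub h => x hx /=; rewrite mem_cat hx.
- move=> b c1 c2 st st' k _ _ h.
  by apply: frame_sub h => x hx /=; rewrite mem_cat hx orbT.
- by move=> b c st st1 st2 k1 k2 _ _ h1 _ h2; apply: (frame_trans _ _ st1).
- by move=> x e st; split=> // y; rewrite inE /= => /negbTE->.
- move=> x e f st; split=> // y; rewrite inE /= => /negbTE hy.
  by apply/funext => j; rewrite hy.
- move=> x e ea y i z j st a p q _ _ _ _ _; split=> // w.
  by rewrite inE /= => /negbTE hw; apply/funext => l; rewrite hw.
Qed.

Definition wp c (t : nat) (Post : state R -> Prop) st :=
  exists st' k, [/\ exec d c st st' k, (k <= t)%N & Post st'].

Lemma wp_frame c t Post st :
  wp c t Post st -> wp c t (fun st' => frame c st st' /\ Post st') st.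
Proof.
move=> [st' [k [ex le h]]]; exists st', k; split=> //; split=> //.
exact: exec_frame ex.
Qed.

Lemma wp_le c t t' Post st : wp c t Post st -> (t <= t')%N -> wp c t' Post st.
Proof.
by move=> [st' [k [ex le h]]] le'; exists st', k; split=> //; apply: leq_trans le'.
Qed.

Lemma wp_impl c t (Post Post' : state R -> Prop) st :
  wp c t Post st -> (forall st', Post st' -> Post' st') -> wp c t Post' st.
Proof.
by move=> [st' [k [ex le h]]] hi; exists st', k; split=> //; apply: hi.
Qed.

Lemma wp_seq c1 c2 t1 t2 Post st :
  wp c1 t1 (wp c2 t2 Post) st -> wp (CSeq c1 c2) (t1 + t2) Post st.
Proof.
move=> [st1 [k1 [ex1 le1 [st2 [k2 [ex2 le2 h]]]]]].
exists st2, (k1 + k2)%N; split=> //; last exact: leq_add.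
exact: ExecSeq ex1 ex2.
Qed.

Lemma wp_skip (Post : state R -> Prop) st : Post st -> wp CSkip 0 Post st.
Proof. by move=> h; do 2 eexists; split; [constructor| |exact: h]. Qed.

Lemma wp_seti x e (Post : state R -> Prop) st :
  Post (set_ivar st x (ieval st e)) -> wp (CSetI x e) (itime e).+1 Post st.
Proof. by move=> h; do 2 eexists; split; [constructor| |exact: h]. Qed.

Lemma wp_setr x e f (Post : state R -> Prop) st :
  Post (set_rarr st x (ieval st e) (reval st f)) ->
  wp (CSetR x e f) (itime e + rtime f).+1 Post st.
Proof. by move=> h; do 2 eexists; split; [constructor| |exact: h]. Qed.

Lemma wp_if b c1 c2 t1 t2 (Post : state R -> Prop) st :
  (beval st b -> wp c1 t1 Post st) -> (~~ beval st b -> wp c2 t2 Post st) ->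
  wp (CIf b c1 c2) (btime b + maxn t1 t2) Post st.
Proof.
move=> h1 h2; case: (boolP (beval st b)) => hb.
  have [st' [k [ex le h]]] := h1 hb.
  exists st', (btime b + k)%N; split=> //; first exact: ExecIfT.
  by rewrite leq_add2l (leq_trans le) // leq_maxl.
have [st' [k [ex le h]]] := h2 hb.
exists st', (btime b + k)%N; split=> //; first exact: ExecIfF.
by rewrite leq_add2l (leq_trans le) // leq_maxr.
Qed.

(** The index of the invariant counts the rounds; [N] bounds it because the
    test fails once the index has reached [N]. *)
Lemma wp_while b c t N (Inv : nat -> state R -> Prop) st :
  Inv 0%N st ->
  (forall i st', frame c st st' -> Inv i st' -> beval st' b ->
     (i < N)%N /\ wp c t (Inv i.+1) st') ->
  wp (CWhile b c) (N * (btime b + t) + btime b)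
     (fun st' => ~~ beval st' b /\ exists i, Inv i st') st.
Proof.
move=> h0 step.
suff gen i st' : frame c st st' -> Inv i st' ->
    wp (CWhile b c) ((N - i) * (btime b + t) + btime b)
      (fun st' => ~~ beval st' b /\ exists i, Inv i st') st'.
  by rewrite -[N]subn0; apply: gen.
have [n] := ubnP (N - i); elim: n i st' => // n IH i st' lt fr hI.
case: (boolP (beval st' b)) => hb; last first.
  exists st', (btime b); split; [exact: ExecWhileF| |by split=> //; exists i].
  exact: leq_addl.
have [ltN [st1 [k1 [ex1 le1 h1]]]] := step i st' fr hI hb.
have [|//|//|st2 [k2 [ex2 le2 h2]]] := IH i.+1 st1; first lia.
  exact: frame_trans fr (exec_frame _ _ _ _ ex1).
exists st2, (btime b + k1 + k2)%N; split=> //; first exact: ExecWhileT ex1 ex2.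
rewrite (_ : (N - i)%N = (N - i.+1).+1); last lia.
rewrite mulSn -!addnA leq_add2l; lia.
Qed.

(** A counting loop; its bound is a variable, so that the bound provably stays
    the same when the body does not write to it. *)
Definition CFor x y c :=
  CSeq (CSetI x (IConst 0))
    (CWhile (BLeI (IAdd (IVar x) (IConst 1)) (IVar y))
       (CSeq c (CSetI x (IAdd (IVar x) (IConst 1))))).

(** The frame from the initial memory is available at every round, so the
    invariant only has to mention what the body changes.  The constants come
    from the test (5), the increment (4) and the initialisation (2). *)
Lemma wp_for x y c t (Inv : nat -> state R -> Prop) st :
  x \notin iwrites c -> y \notin x :: iwrites c ->
  Inv 0%N (set_ivar st x 0) ->
  (forall i st', frame (CFor x y c) st st' -> ivar st' x = i ->
     (i < ivar st y)%N -> Inv i st' ->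
     wp c t (fun st1 => frame (CFor x y c) st st1 ->
               Inv i.+1 (set_ivar st1 x i.+1)) st') ->
  wp (CFor x y c) (ivar st y * (t + 9) + 7) (Inv (ivar st y)) st.
Proof.
move=> xc; rewrite inE negb_or => /andP[yx yc] h0 step.
set n := ivar st y.
pose C := CFor x y c.
have CS0 : frame C st (set_ivar st x 0).
  by split=> // z; rewrite /= inE negb_or => /andP[/negbTE-> _].
have yC : y \notin iwrites C by rewrite /= !(inE, mem_cat) !negb_or yx yc.
apply: (@wp_le _ (2 + (n * (5 + (t + 4)) + 5))); last lia.
apply: wp_seq; apply: wp_seti => /=.
apply: wp_impl.
  apply: (@wp_while _ _ _ n
    (fun i st' => [/\ frame C st st', ivar st' x = i, (i <= n)%N & Inv i st'])).
    by split=> //=; rewrite eqxx.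
  move=> i st' _ [fr ix le hI] /=; rewrite ix fr.1 // addn1 -/n => lt.
  split=> //; apply: wp_seq.
  have := wp_frame _ _ _ _ (step i st' fr ix lt hI).
  move=> /wp_impl; apply=> st1 [fr1 h1].
  apply: wp_seti => /=; rewrite fr1.1 // ix addn1.
  have fr1' : frame C st st1.
    apply: frame_trans fr (frame_sub _ _ _ _ _ _ fr1) => z hz /=;
      by rewrite ?inE !mem_cat hz ?orbT.
  split=> //=; last exact: h1.
    apply: (frame_trans _ _ _ _ fr1'); split=> // z.
    by rewrite /= inE negb_or => /andP[/negbTE-> _].
  by rewrite eqxx.
move=> st' [hb [i [fr ix le hI]]]; move: hb; rewrite /= ix fr.1 // addn1 -/n -leqNgt => ge.
by rewrite (_ : n = i) //; lia.
Qed.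
End Logic.

(** * The bisection program *)

Section Program.
Variables (Q : cmd) (m : nat).

(* The names of the integer variables, then those of the arrays.  Every real
   scalar is cell 0 of an array of its own. *)
Local Notation vS := m (only parsing).
Local Notation vA := (m + 1)%N (only parsing).
Local Notation vN := (m + 2)%N (only parsing).
Local Notation vs := (m + 10)%N (only parsing).
Local Notation va := (m + 11)%N (only parsing).
Local Notation vj := (m + 12)%N (only parsing).
Local Notation vf := (m + 13)%N (only parsing).
Local Notation aR := m (only parsing).
Local Notation aP := (m + 1)%N (only parsing).
Local Notation aV := (m + 2)%N (only parsing).
Local Notation aLam := (m + 3)%N (only parsing).
Local Notation aKap := (m + 4)%N (only parsing).
Local Notation aEps := (m + 5)%N (only parsing).
Local Notation aTop := (m + 6)%N (only parsing).
Local Notation aLo := (m + 10)%N (only parsing).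
Local Notation aHi := (m + 11)%N (only parsing).
Local Notation aMid := (m + 12)%N (only parsing).
Local Notation aSum := (m + 13)%N (only parsing).
Local Notation aOut := (m + 14)%N (only parsing).

Local Notation get y := (RGet y (IConst 0)) (only parsing).
Local Notation set y f := (CSetR y (IConst 0) f).

(** The position of entry [vj] of the vector of state [vs] and action [va]. *)
Definition cell : iexp :=
  IAdd (IMul (IAdd (IMul (IVar vs) (IVar vA)) (IVar va)) (IVar vS)) (IVar vj).

Definition load : cmd :=
  CFor vj vS
    (CSeq (CSetR 0 (IVar vj)
             (RAdd (RGet aR cell) (RMul (get aLam) (RGet aV (IVar vj)))))
          (CSetR 1 (IVar vj) (RGet aP cell))).

(** The integer variable [vf] is zero once some projection was infeasible; then
    the sum of the projections is infinite, whatever is in [aSum]. *)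
Definition query : cmd :=
  CSeq load
  (CSeq (set 2 (get aMid))
  (CSeq (CSetI 0 (IVar vS))
  (CSeq (CSetI 1 (IVar vA))
  (CSeq (CSetI 2 (IVar va))
  (CSeq Q
  (CIf (BLeI (IVar 3) (IConst 0))
     (CSetI vf (IConst 0))
     (set aSum (RAdd (get aSum) (get 3))))))))).

Definition test : cmd :=
  CSeq (set aSum (RNat (IConst 0)))
  (CSeq (CSetI vf (IConst 1))
  (CFor va vA query)).

Definition bisect : cmd :=
  CSeq (set aMid (RDiv (RAdd (get aLo) (get aHi)) (RNat (IConst 2))))
  (CSeq test
  (CIf (BLeI (IVar vf) (IConst 0))
     (set aLo (get aMid))
     (CIf (BLeR (get aSum) (get aKap))
        (set aHi (get aMid))
        (set aLo (get aMid))))).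

Definition solve : cmd :=
  CSeq (set aLo (RNat (IConst 0)))
  (CSeq (set aHi (get aTop))
  (CSeq (CWhile (BNot (BLeR (RSub (get aHi) (get aLo)) (get aEps))) bisect)
  (CSetR aOut (IVar vs) (get aHi)))).

(** The largest reward is found while the rewards are copied; dividing it by
    [1 - lambda] at the end gives [Rbar]. *)
Definition init : cmd :=
  CSeq (CSetI vS (IVar 0))
  (CSeq (CSetI vA (IVar 1))
  (CSeq (CSetI vN (IMul (IMul (IVar vS) (IVar vA)) (IVar vS)))
  (CSeq (set aLam (get 3))
  (CSeq (set aKap (get 4))
  (CSeq (set aEps (get 5))
  (CSeq (set aTop (RNat (IConst 0)))
  (CSeq (CFor vj vN
    (CSeq (CSetR aR (IVar vj) (RGet 0 (IVar vj)))
    (CSeq (CSetR aP (IVar vj) (RGet 1 (IVar vj)))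
    (CIf (BLeR (RGet 0 (IVar vj)) (get aTop))
       CSkip
       (set aTop (RGet 0 (IVar vj)))))))
  (CSeq (CFor vj vS (CSetR aV (IVar vj) (RGet 2 (IVar vj))))
  (set aTop (RDiv (get aTop)
                  (RSub (RNat (IConst 1)) (get aLam)))))))))))).

Definition bellman_program : cmd :=
  CSeq init
  (CSeq (CFor vs vS solve)
  (CFor vj vS (CSetR 6 (IVar vj) (RGet aOut (IVar vj))))).

(* [m] lies beyond the input and output arrays and beyond the names that [Q]
   writes to. *)
Hypothesis m_gt6 : (6 < m)%N.
Hypothesis Qi : forall x, (m <= x)%N -> x \notin iwrites Q.
Hypothesis Qr : forall x, (m <= x)%N -> x \notin rwrites Q.

Ltac not_in_writes :=
  rewrite /= ?(mem_cat, in_cons, in_nil) ?negb_or;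
  repeat (apply/andP; split); try done;
  first [by apply: Qi; lia | by apply: Qr; lia | lia].

Ltac unwritten := clear -m_gt6 Qi Qr; not_in_writes.

Ltac unwritten_input :=
  let x := fresh in let hx := fresh in
  intros x hx; clear -m_gt6 Qi Qr hx; not_in_writes.

Ltac neqs :=
  repeat match goal with |- context [@eq_op _ ?a ?b] =>
    rewrite (_ : (@eq_op _ a b) = false);
      [| first [by rewrite eqn_add2l | clear -m_gt6; lia]] end.

Variables (R : realType) (nS nA : nat) (d : deviations R nS nA).
Hypothesis hd : deviation_axioms d.
Variables (r pbar : 'I_nS -> 'I_nA -> 'rV[R]_nS).
Variables (lambda kappa eps : R) (v : 'rV[R]_nS).
Hypothesis r_ge0 : forall s a s', 0 <= r s a 0 s'.
Hypothesis hpbar : forall s a, simplex (pbar s a).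
Hypothesis hlambda : 0 < lambda < 1.
Hypothesis v_ge0 : forall s, 0 <= v 0 s.

Lemma lambda_ge0 : 0 <= lambda.
Proof. by case/andP: hlambda => /ltW. Qed.

Lemma onem_lambda_gt0 : 0 < 1 - lambda.
Proof. by case/andP: hlambda; rewrite subr_gt0. Qed.

(** The data of the instance, in the protected names [m .. m + 9].  All commands
    after [init] write below [m] or from [m + 10] on. *)
Definition ready (st : state R) : Prop :=
  [/\ ivar st vS = nS & ivar st vA = nA] /\
  [/\ (forall (s : 'I_nS) (a : 'I_nA) (j : 'I_nS),
         rarr st aR ((s * nA + a) * nS + j)%N = r s a 0 j),
      (forall (s : 'I_nS) (a : 'I_nA) (j : 'I_nS),
         rarr st aP ((s * nA + a) * nS + j)%N = pbar s a 0 j)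
    & (forall j : 'I_nS, rarr st aV j = v 0 j)] /\
  [/\ rarr st aLam 0 = lambda, rarr st aKap 0 = kappa,
      rarr st aEps 0 = eps & rarr st aTop 0 = Rbar r lambda].

Lemma ready_frame c (st st' : state R) :
  (forall x, (m <= x < m + 10)%N -> x \notin iwrites c) ->
  (forall y, (m <= y < m + 10)%N -> y \notin rwrites c) ->
  frame _ c st st' -> ready st -> ready st'.
Proof.
move=> hi hr [fi fr] [[h1 h2] [[h3 h4 h5] [h6 h7 h8 h9]]].
split; first by split; rewrite fi //; apply: hi; lia.
split; first by split=> *; rewrite fr //; apply: hr; lia.
by split; rewrite fr //; apply: hr; lia.
Qed.

Ltac stay_ready :=
  eapply ready_frame; [idtac | idtac | eassumption | assumption];
  unwritten_input.

Lemma wp_load (st : state R) (s : 'I_nS) (a : 'I_nA) :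
  ready st -> ivar st vs = s -> ivar st va = a ->
  wp R nS nA d load (nS * 39 + 7)
    (fun st' => forall j : 'I_nS,
       rarr st' 0 j = (r s a + lambda *: v) 0 j /\
       rarr st' 1 j = pbar s a 0 j) st.
Proof.
move=> rd hs ha.
have [[eS eA] _] := rd; rewrite -[X in (X * 39)%N]eS.
pose Inv i (st' : state R) := forall j : 'I_nS, (j < i)%N ->
  rarr st' 0 j = (r s a + lambda *: v) 0 j /\ rarr st' 1 j = pbar s a 0 j.
apply: (wp_impl _ _ _ _ _ _ (Inv (ivar st vS))); last first.
  by move=> st' h j; apply: h; rewrite eS.
apply: (wp_for _ _ _ _ _ _ _ 30) => //; try unwritten.
rewrite eS => i st' fr ij lti IH.
have rd' : ready st' by stay_ready.
have [[eS' eA'] [[eR eP eV] [eL _ _ _]]] := rd'.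
have vs' : ivar st' vs = s by rewrite fr.1 //; unwritten.
have va' : ivar st' va = a by rewrite fr.1 //; unwritten.
apply: (@wp_seq _ _ _ _ _ _ 18 12); apply: wp_setr; apply: wp_setr => _ j.
rewrite /= ij vs' va' eS' eA' ltnS.
neqs; rewrite /=; case: eqP => [ji|ne] le; last by apply: IH; lia.
by rewrite eL -ji eR eP eV !mxE.
Qed.

Definition proj (s : 'I_nS) (a : 'I_nA) (theta : R) := projection d a (pbar s a) (r s a + lambda *: v) theta.

(** The accumulated sum of projections, as an extended real. *)
Definition acc (st : state R) : \bar R :=
  if ivar st vf == 0%N then +oo%E else (rarr st aSum 0)%:E.

Variable K : nat.
Hypothesis hQ : forall (a : 'I_nA) (pb b : 'rV[R]_nS) (beta : R) (st : state R),
  simplex pb -> (forall i, 0 <= b 0 i) -> 0 <= beta ->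
  projection_input a pb b beta st ->
  wp R nS nA d Q K
    (fun st' => projection_output st' = projection d a pb b beta) st.

Definition query_time := (nS * 39 + 7 + (4 + (2 + (2 + (2 + (K + (3 + 7)))))))%N.

Lemma wp_query (st : state R) (s : 'I_nS) (a : 'I_nA) :
  ready st -> ivar st vs = s -> ivar st va = a -> 0 <= rarr st aMid 0 ->
  wp R nS nA d query query_time
    (fun st' => acc st' = (acc st + proj s a (rarr st aMid 0%N))%E) st.
Proof.
move=> rd hs ha mid0.
apply: wp_seq; have := wp_frame _ _ _ _ _ _ _ _ (wp_load _ _ _ rd hs ha).
move=> /wp_impl; apply=> st1 [fr1 h1].
have rd1 : ready st1 by stay_ready.
have [[eS eA] _] := rd1.
do 4 (apply: wp_seq; first [apply: wp_setr | apply: wp_seti]).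
apply: wp_seq; set st2 := set_ivar _ 2 _.
have in2 : projection_input a (pbar s a) (r s a + lambda *: v) (rarr st aMid 0) st2.
  split; split=> /=.
  - by [].
  - by neqs.
  - by neqs; rewrite /= fr1.1 //; unwritten.
  - by move=> i; have [] := h1 i.
  - by move=> i; have [] := h1 i.
  - by rewrite fr1.2 //; unwritten.
have b_ge0 i : 0 <= (r s a + lambda *: v) 0 i.
  by rewrite !mxE addr_ge0 // mulr_ge0 // lambda_ge0.
have := wp_frame _ _ _ _ _ _ _ _ (hQ _ _ _ _ _ (hpbar s a) b_ge0 mid0 in2).
move=> /wp_impl; apply=> st3 [fr3 h3].
have evf : ivar st3 vf = ivar st vf.
  rewrite fr3.1; last unwritten; rewrite /=.
  neqs; rewrite /=.
  by rewrite fr1.1 //; unwritten.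
have esum : rarr st3 aSum 0 = rarr st aSum 0.
  rewrite fr3.2; last unwritten; rewrite /=.
  neqs; rewrite /=.
  by rewrite fr1.2 //; unwritten.
rewrite /proj -h3 /acc -evf -esum /projection_output.
apply: (@wp_if _ _ _ _ _ _ _ 2 7); rewrite /= leqn0 => hb.
  apply: wp_seti; rewrite /= eqxx hb.
  by case: ifP.
apply: wp_setr; rewrite /= (negbTE hb) eqxx.
by case: ifP.
Qed.

Definition test_time := (4 + (2 + (nA * (query_time + 9) + 7)))%N.

Lemma wp_test (st : state R) (s : 'I_nS) :
  ready st -> ivar st vs = s -> 0 <= rarr st aMid 0 ->
  wp R nS nA d test test_time
    (fun st' => acc st' = (\sum_a proj s a (rarr st aMid 0%N))%E) st.
Proof.
move=> rd hs mid0.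
apply: wp_seq; apply: wp_setr; apply: wp_seq; apply: wp_seti.
set st1 := set_ivar _ _ _.
have rd1 : ready st1.
  apply: (ready_frame (CSeq (set aSum (RNat (IConst 0))) (CSetI vf (IConst 1))) st) => //.
  - unwritten_input.
  - unwritten_input.
  - split=> x; rewrite /= in_cons in_nil orbF => /negbTE hx; first by rewrite hx.
    by apply/funext => j; rewrite hx.
have hs1 : ivar st1 vs = s by rewrite /= eqn_add2l.
have mid1 : rarr st1 aMid 0 = rarr st aMid 0.
  by rewrite /= eqn_add2l.
have acc1 : acc st1 = 0%:E by rewrite /acc /= !eqxx.
rewrite -mid1 in mid0 *.
have [[eS1 eA1] _] := rd1; rewrite -[X in (X * _)%N]eA1.
set th := rarr st1 aMid 0.
pose Inv i (st' : state R) := acc st' = (\sum_(a < nA | (a < i)%N) proj s a th)%E.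
apply: (wp_impl _ _ _ _ _ _ (Inv (ivar st1 vA))); last first.
  move=> st' ->; rewrite eA1; apply: eq_bigl => a; exact: ltn_ord.
apply: wp_for; try unwritten.
  rewrite /Inv big1 //; apply: etrans acc1.
  by rewrite /acc; cbn [ivar set_ivar]; neqs.
rewrite eA1 => i st' fr ij lti IH.
have rd' : ready st' by stay_ready.
have mid' : rarr st' aMid = rarr st1 aMid by rewrite fr.2 //; unwritten.
have hs' : ivar st' vs = s by rewrite fr.1 //; unwritten.
have := wp_query st' s (Ordinal lti) rd' hs' ij; rewrite mid' => /(_ mid0).
move=> /wp_impl; apply=> st2 acc2 _.
rewrite /Inv /acc /= eqn_add2l /=.
rewrite -/(acc st2) acc2 IH addeC.
rewrite [RHS](bigD1 (Ordinal lti)) //=; congr (_ + _)%E.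
by apply: eq_bigl => a; rewrite ltnS -val_eqE /= ltn_neqAle andbC.
Qed.

Hypothesis nA_gt0 : (0 < nA)%N.
Hypothesis kappa_gt0 : 0 < kappa.
Hypothesis eps_gt0 : 0 < eps.
Hypothesis v_le : forall s, v 0 s <= Rbar r lambda.

Local Notation B s := (bellman d r pbar lambda kappa v 0 s).

Lemma reward_le s a j : r s a 0 j <= (1 - lambda) * Rbar r lambda.
Proof.
rewrite /Rbar mulrA mulfV ?mul1r ?gt_eqF ?onem_lambda_gt0 //.
exact: (@le_bigmax _ _ _ _ (fun i => r i.1.1 i.1.2 0 i.2) (s, a, j)).
Qed.

(** [Rbar] is the fixed point of [x |-> max r + lambda x]. *)
Lemma target_bounds s a j : 0 <= (r s a + lambda *: v) 0 j <= Rbar r lambda.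
Proof.
rewrite !mxE addr_ge0 //=; last by rewrite mulr_ge0 // lambda_ge0.
have := reward_le s a j; have := ler_wpM2l lambda_ge0 (v_le j).
lra.
Qed.

Lemma bellmanE s : B s = game_value R nS nA d (pbar s) (fun a => r s a + lambda *: v) kappa.
Proof. by rewrite mxE. Qed.

Definition bisect_time := (10 + (test_time + (3 + maxn 4 (5 + maxn 4 4))))%N.

Lemma wp_bisect (st : state R) (s : 'I_nS) :
  ready st -> ivar st vs = s ->
  0 <= rarr st aLo 0 <= B s -> B s <= rarr st aHi 0 ->
  wp R nS nA d bisect bisect_time
    (fun st' => [/\ 0 <= rarr st' aLo 0 <= B s, B s <= rarr st' aHi 0 &
       rarr st' aHi 0 - rarr st' aLo 0 = (rarr st aHi 0 - rarr st aLo 0) / 2])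
    st.
Proof.
move=> rd hs /andP[lo0 loB] hiB.
apply: wp_seq; apply: wp_setr.
set st1 := set_rarr _ _ _ _.
set lo := rarr st aLo 0 in lo0 loB *; set hi := rarr st aHi 0 in hiB *.
have rd1 : ready st1.
  apply: (ready_frame (set aMid (RNat (IConst 0))) st) => //.
  - unwritten_input.
  - split=> // x; rewrite /= in_cons in_nil orbF => /negbTE hx.
    by apply/funext => j; rewrite hx.
have mid1 : rarr st1 aMid 0 = (lo + hi) / 2 by rewrite /= eqxx.
have lo1 : rarr st1 aLo 0 = lo.
  by rewrite /= eqn_add2l.
have hi1 : rarr st1 aHi 0 = hi.
  by rewrite /= eqn_add2l.
have mid0 : 0 <= rarr st1 aMid 0 by rewrite mid1; lra.
apply: wp_seq; have := wp_frame _ _ _ _ _ _ _ _ (wp_test st1 s rd1 hs mid0).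
move=> /wp_impl; apply=> st2 [fr2 acc2].
have rd2 : ready st2 by stay_ready.
have [_ [_ [_ eK _ _]]] := rd2.
have mid2 : rarr st2 aMid 0 = (lo + hi) / 2 by rewrite fr2.2 //; unwritten.
have lo2 : rarr st2 aLo 0 = lo by rewrite fr2.2 //; unwritten.
have hi2 : rarr st2 aHi 0 = hi by rewrite fr2.2 //; unwritten.
have [mid midE] : exists mid, mid = (lo + hi) / 2 by eexists.
rewrite -midE in mid1 mid2.
have feas : (acc st2 <= kappa%:E)%E -> B s <= mid.
  rewrite acc2 mid1 bellmanE.
  exact: game_value_le_feasible (target_bounds s) _.
have infeas : (kappa%:E < acc st2)%E -> mid <= B s.
  rewrite acc2 mid1 bellmanE.
  exact: le_game_value_infeasible (target_bounds s) _.
have goLo : mid <= B s -> forall t, (4 <= t)%N -> wp R nS nA d (set aLo (get aMid)) t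
    (fun st' => [/\ 0 <= rarr st' aLo 0 <= B s, B s <= rarr st' aHi 0 &
       rarr st' aHi 0 - rarr st' aLo 0 = (hi - lo) / 2]) st2.
  move=> le t ht; apply: wp_le ht; apply: wp_setr; rewrite /= !eqxx mid2.
  rewrite eqn_add2l /=.
  by rewrite hi2; split; [apply/andP; split| |]; lra.
apply: wp_if => /=; rewrite leqn0 => hf.
  by apply: goLo => //; apply: infeas; rewrite /acc hf ltry.
apply: wp_if => /= hk.
  apply: wp_setr; rewrite /= !eqxx mid2.
  rewrite eqn_add2l /=.
  have Bmid : B s <= mid.
    by apply: feas; move: hk; rewrite /acc (negbTE hf) lee_fin eK.
  by rewrite lo2; split; [apply/andP; split| |]; lra.
apply: goLo => //; apply: infeas.
by move: hk; rewrite /acc (negbTE hf) lte_fin ltNge eK.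
Qed.

Variable N : nat.
Hypothesis hN : Rbar r lambda <= eps * 2 ^+ N.

Definition solve_time := (4 + (4 + ((N * (9 + bisect_time) + 9) + 4)))%N.

(** After [i] rounds the interval has length [Rbar / 2 ^ i]; by the choice of
    [N] the loop has stopped when [i] reaches [N]. *)
Lemma wp_solve (st : state R) (s : 'I_nS) :
  ready st -> ivar st vs = s ->
  wp R nS nA d solve solve_time
    (fun st' => `|rarr st' aOut s - B s| <= eps /\
       forall i : nat, i != s -> rarr st' aOut i = rarr st aOut i) st.
Proof.
move=> rd hs.
apply: wp_seq; apply: wp_setr; apply: wp_seq; apply: wp_setr.
set st1 := set_rarr _ aHi _ _.
have rd1 : ready st1.
  apply: (ready_frame (CSeq (set aLo (RNat (IConst 0))) (set aHi (RNat (IConst 0)))) st) => //.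
  - unwritten_input.
  - split=> // x; rewrite /= in_cons negb_or in_cons in_nil orbF => /andP[/negbTE h1 /negbTE h2].
    by apply/funext => j; rewrite h1 h2.
have [_ [_ [_ _ _ eT]]] := rd.
have lo1 : rarr st1 aLo 0 = 0.
  by rewrite /= !eqxx eqn_add2l.
have hi1 : rarr st1 aHi 0 = Rbar r lambda.
  by rewrite /= !eqxx /= eqn_add2l.
have := game_value_bounds R nS nA d hd (pbar s) (fun a => r s a + lambda *: v) kappa
   (Rbar r lambda) nA_gt0 (hpbar s) kappa_gt0 (target_bounds s).
rewrite -bellmanE => /andP[B0 BT].
apply: wp_seq.
have := wp_while R nS nA d _ bisect bisect_time N (fun i st' =>
   [/\ 0 <= rarr st' aLo 0 <= B s, B s <= rarr st' aHi 0 &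
       rarr st' aHi 0 - rarr st' aLo 0 = Rbar r lambda / 2 ^+ i]) st1.
move=> /(_ (BNot (BLeR (RSub (get aHi) (get aLo)) (get aEps)))) [].
- by rewrite lo1 hi1 lexx B0 BT subr0 expr0 divr1.
- move=> i st' fr [h1 h2 h3] /= hb.
  have rd' : ready st' by stay_ready.
  have hs' : ivar st' vs = s by rewrite fr.1 //; unwritten.
  have [_ [_ [_ _ eE _]]] := rd'.
  split; last first.
    have := wp_bisect st' s rd' hs' h1 h2 => /wp_impl; apply=> st2 [g1 g2 g3].
    by split=> //; rewrite g3 h3 exprSr invfM mulrA.
  rewrite ltnNge; apply/negP => leNi; move/negP: hb; apply.
  rewrite h3 eE ler_pdivrMr ?exprn_gt0 //; apply: le_trans hN _.
  by rewrite ler_pM2l // ler_eXn2l // ltr1n.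
move=> st2 [k [ex le h]].
have fr2 := exec_frame _ _ _ _ _ _ _ _ ex.
exists st2, k; split=> //; case: h => hb [i [h1 h2 h3]].
have rd2 : ready st2 by stay_ready.
have hs2 : ivar st2 vs = s by rewrite fr2.1 //; unwritten.
have [_ [_ [_ _ eE _]]] := rd2.
move: hb; rewrite /= negbK eE => hle.
apply: (@wp_setr _ _ _ _ _ (IVar vs) (get aHi)) => /=; rewrite !eqxx hs2 !eqxx /=.
split=> [|j js]; first by rewrite ger0_norm; lra.
rewrite (negbTE js).
have -> : rarr st2 aOut = rarr st1 aOut by rewrite fr2.2 //; unwritten.
rewrite /= eqn_add2l /=.
by rewrite eqn_add2l.
Qed.

Definition init_time := (2 + (2 + (6 + (4 + (4 + (4 + (4 +
  ((nS * nA * nS * 26 + 7) + ((nS * 13 + 7) + 10)))))))))%N.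

Lemma flat_index (s : 'I_nS) (a : 'I_nA) (j : 'I_nS) :
  ((s * nA + a) * nS + j < nS * nA * nS)%N.
Proof.
have h1 : (s * nA + a < nS * nA)%N.
  apply: (@leq_trans (s.+1 * nA)); first by rewrite mulSn addnC ltn_add2r.
  by rewrite leq_mul2r ltn_ord orbT.
apply: (@leq_trans ((s * nA + a).+1 * nS)).
  by rewrite mulSn addnC ltn_add2r.
by rewrite leq_mul2r h1 orbT.
Qed.

Lemma unflatten i : (i < nS * nA * nS)%N ->
  exists (s : 'I_nS) (a : 'I_nA) (j : 'I_nS), i = ((s * nA + a) * nS + j)%N.
Proof.
move=> lti.
have nS0 : (0 < nS)%N by move: lti; case: (nS) => //; rewrite muln0.
have lq : (i %/ nS < nS * nA)%N by rewrite ltn_divLR.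
have ls : (i %/ nS %/ nA < nS)%N by rewrite ltn_divLR.
exists (Ordinal ls), (Ordinal (ltn_pmod (i %/ nS) nA_gt0)),
  (Ordinal (ltn_pmod i nS0)).
by rewrite /= -!divn_eq.
Qed.

Lemma wp_init (st : state R) :
  bellman_input r pbar lambda kappa eps v st ->
  wp R nS nA d init init_time ready st.
Proof.
move=> [[eS eA] [[eR eP eV] [eL eK eE]]].
do 7 (apply: wp_seq; first [apply: wp_seti | apply: wp_setr]).
set st1 := set_rarr _ aTop _ _.
have S1 : ivar st1 vS = nS by rewrite /=; neqs; rewrite eqxx.
have A1 : ivar st1 vA = nA by rewrite /=; neqs; rewrite /= eqxx.
have N1 : ivar st1 vN = (nS * nA * nS)%N.
  by rewrite /=; neqs; rewrite /= !eqxx; neqs; rewrite /= eS eA.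
have low y : (y < 7)%N -> rarr st1 y = rarr st y.
  move=> ly; apply/funext => j; have ne k : (y == m + k)%N = false by lia.
  by rewrite /= !ne.
have L1 : rarr st1 aLam 0 = lambda by rewrite /=; neqs; rewrite /= eqxx.
have K1 : rarr st1 aKap 0 = kappa by rewrite /=; neqs; rewrite /= eqxx.
have E1 : rarr st1 aEps 0 = eps by rewrite /=; neqs; rewrite /= eqxx.
have T1 : rarr st1 aTop 0 = 0 by rewrite /= !eqxx.
pose T := \big[Num.max/0]_(i : 'I_nS * 'I_nA * 'I_nS) r i.1.1 i.1.2 0 i.2.
(* The maximum is described by two inequalities since the loop runs over flat
   positions, not over the triples that index [T]. *)
pose Inv i (st' : state R) :=
  (forall j, (j < i)%N -> [/\ rarr st' aR j = rarr st 0 j,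
      rarr st' aP j = rarr st 1 j & rarr st 0 j <= rarr st' aTop 0]) /\
  0 <= rarr st' aTop 0 <= T.
have T0 : 0 <= T by exact: bigmax_ge_id.
apply: wp_seq; rewrite -[X in (X * 26)%N]N1.
apply: (wp_impl _ _ _ _ _ _ (fun st' => frame R (CFor vj vN
    (CSeq (CSetR aR (IVar vj) (RGet 0 (IVar vj)))
    (CSeq (CSetR aP (IVar vj) (RGet 1 (IVar vj)))
    (CIf (BLeR (RGet 0 (IVar vj)) (get aTop))
       CSkip
       (set aTop (RGet 0 (IVar vj))))))) st1 st' /\ Inv (ivar st1 vN) st')).
  apply: wp_frame; apply: (wp_for _ _ _ _ _ _ _ 17) => //; try unwritten.
    by split=> //; rewrite T1 lexx.
  rewrite N1 => i st' fr ij lti [IH /andP[t0 tT]].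
  apply: (@wp_seq _ _ _ _ _ _ 4 13); apply: wp_setr.
  apply: (@wp_seq _ _ _ _ _ _ 4 9); apply: wp_setr.
  set st2 := set_rarr _ aP _ _.
  have low2 y : (y < 7)%N -> rarr st2 y = rarr st y.
    move=> ly; rewrite -low //; apply/funext => j.
    have ne k : (y == m + k)%N = false by lia.
    rewrite /= ne (_ : (y == m) = false) /=; last by lia.
    by rewrite fr.2 //; clear -ly m_gt6; not_in_writes.
  have ij2 : ivar st2 vj = i by [].
  have top2 : rarr st2 aTop 0 = rarr st' aTop 0 by rewrite /=; neqs.
  have Fi : rarr st 0 i <= T.
    have [s [a [j ->]]] := unflatten i lti; rewrite eR.
    exact: (@le_bigmax _ _ _ _ (fun i => r i.1.1 i.1.2 0 i.2) (s, a, j)).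
  have R2 j : (j < i.+1)%N -> rarr st2 aR j = rarr st 0 j.
    rewrite ltnS leq_eqVlt => hj; rewrite /=; neqs; rewrite /= eqxx ij /=.
    case: eqP hj => [->|_] /= hj; first by rewrite fr.2 ?low //; unwritten.
    by have [] := IH j hj.
  have P2 j : (j < i.+1)%N -> rarr st2 aP j = rarr st 1 j.
    rewrite ltnS leq_eqVlt => hj; rewrite /= eqxx ij /=; neqs.
    case: eqP hj => [->|_] /= hj; first by rewrite fr.2 ?low //; unwritten.
    by have [] := IH j hj.
  clearbody st2.
  apply: (@wp_if _ _ _ _ _ _ _ 0 4) => /=; rewrite ij2 low2 // top2.
    move=> hle; apply: wp_skip => _; split=> [j hj|]; last by rewrite /= top2 t0.
    split; [exact: R2|exact: P2|].
    rewrite /= top2.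
    move: hj; rewrite ltnS leq_eqVlt => /orP[/eqP->//|hj].
    by have [] := IH j hj.
  rewrite -ltNge => hlt; apply: wp_setr => _.
  have Fi' : rarr st2 0 i = rarr st 0 i by rewrite low2.
  split=> [j hj|]; last first.
    by rewrite /= !eqxx ij2 Fi' Fi (le_trans t0) // ltW.
  split.
  - by rewrite -R2 //=; neqs.
  - by rewrite -P2 //=; neqs.
  - rewrite /= !eqxx ij2 Fi'.
    move: hj; rewrite ltnS leq_eqVlt => /orP[/eqP->//|hj].
    by have [_ _ /le_trans] := IH j hj; apply; exact: ltW.
move=> st2 [fr2]; rewrite N1 => [[I2 /andP[t0 tT]]].
have S2 : ivar st2 vS = nS by rewrite fr2.1 //; unwritten.
apply: wp_seq; rewrite -[X in (X * 13)%N]S2.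
pose Inv' i (st' : state R) :=
  forall j, (j < i)%N -> rarr st' aV j = rarr st 2 j.
apply: (wp_impl _ _ _ _ _ _ (fun st' => frame R (CFor vj vS
   (CSetR aV (IVar vj) (RGet 2 (IVar vj)))) st2 st' /\ Inv' (ivar st2 vS) st')).
  apply: wp_frame; apply: (wp_for _ _ _ _ _ _ _ 4) => //; try unwritten.
  move=> i st' fr ij lti IH; apply: wp_setr => _ j.
  rewrite /= eqxx ij ltnS leq_eqVlt /=.
  case: eqP => [->|_] /=; last exact: IH.
  by rewrite fr.2 ?fr2.2 ?low //; unwritten.
move=> st3 [fr3]; rewrite S2 => I3.
have keep y : y != aV -> y \notin [:: aR; aP; aTop] -> rarr st3 y = rarr st1 y.
  by move=> h1 h2; rewrite fr3.2 ?fr2.2 //= in_cons in_nil orbF.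
have R3 y : y != aV -> rarr st3 y = rarr st2 y.
  by move=> h1; rewrite fr3.2 //= in_cons in_nil orbF.
have L3 : rarr st3 aLam 0 = lambda.
  by rewrite keep //; clear -m_gt6; not_in_writes.
have T3 : rarr st3 aTop 0 = T.
  rewrite R3; last by clear; lia.
  apply/eqP; rewrite eq_le tT; apply: bigmax_le => // -[[s a] j] _ /=.
  by have [_ _] := I2 _ (flat_index s a j); rewrite eR.
apply: wp_setr; split; first split.
- by rewrite /= fr3.1 ?fr2.1 //; unwritten.
- by rewrite /= fr3.1 ?fr2.1 //; unwritten.
split; first split.
- move=> s a j; rewrite /=; neqs; rewrite /= R3; last by clear; lia.
  by have [-> _ _] := I2 _ (flat_index s a j).
- move=> s a j; rewrite /=; neqs; rewrite /= R3; last by clear; lia.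
  by have [_ -> _] := I2 _ (flat_index s a j).
- by move=> j; rewrite /=; neqs; rewrite /= I3.
split.
- by rewrite /=; neqs; rewrite /= L3.
- by rewrite /=; neqs; rewrite /= keep //; clear -m_gt6; not_in_writes.
- by rewrite /=; neqs; rewrite /= keep //; clear -m_gt6; not_in_writes.
- by rewrite /= !eqxx /= T3 L3 mulrC.
Qed.

Definition program_time :=
  (init_time + ((nS * (solve_time + 9) + 7) + (nS * 13 + 7)))%N.

Lemma wp_program (st : state R) :
  bellman_input r pbar lambda kappa eps v st ->
  wp R nS nA d bellman_program program_time
    (fun st' => forall s : 'I_nS, `|rarr st' 6 s - B s| <= eps) st.
Proof.
move=> hin; apply: wp_seq; move: (wp_init st hin) => /wp_impl; apply.
move=> st1 rd1; have [[S1 _] _] := rd1.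
pose Inv y i (st' : state R) :=
  forall s : 'I_nS, (s < i)%N -> `|rarr st' y s - B s| <= eps.
apply: wp_seq; rewrite -[X in (X * (solve_time + 9))%N]S1.
apply: (wp_impl _ _ _ _ _ _
  (fun st' => frame R (CFor vs vS solve) st1 st' /\ Inv aOut (ivar st1 vS) st')).
  apply: wp_frame; apply: wp_for => //; try unwritten.
  rewrite S1 => i st' fr ij lti IH.
  have rd' : ready st' by stay_ready.
  have := wp_solve st' (Ordinal lti) rd' ij.
  move=> /wp_impl; apply=> st2 [h1 h2] _ s; rewrite ltnS leq_eqVlt /=.
  case: eqP => [si _|/eqP ne /= hs]; last by rewrite h2 //; exact: IH.
  by rewrite (_ : s = Ordinal lti) //; apply: val_inj.
move=> st2 [fr2]; rewrite S1 => I2.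
have S2 : ivar st2 vS = nS by rewrite fr2.1 //; unwritten.
rewrite -[X in (X * 13)%N]S2.
apply: (wp_impl _ _ _ _ _ _ (Inv 6%N (ivar st2 vS))); last first.
  by move=> st' h s; apply: h; rewrite S2.
apply: (wp_for _ _ _ _ _ _ _ 4) => //; try unwritten.
move=> i st' fr ij lti IH; apply: wp_setr => _ s.
rewrite /= ij ltnS leq_eqVlt.
case: eqP => [si _|_ /= hs]; last exact: IH.
by rewrite fr.2; [rewrite -si; exact: I2 | unwritten].
Qed.
End Program.

(** * Number of rounds and total time *)

(** Take [log2 (x / y)] rounded down, plus one, and 0 if [x <= y].  The leading 2
    of the constant pays for this rounding and for the successor of [N]. *)
Lemma exists_halvings (R : realType) (x y : R) : 0 <= x -> 0 < y ->
  exists N : nat, x <= y * 2 ^+ N /\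
    N.+1%:R <= (2 + (ln 2)^-1) * Num.max 1 (ln (x / y)).
Proof.
move=> x0 y0; have ln20 : 0 < ln 2 :> R by rewrite ln_gt0 // ltr1n.
have max1 : 1 <= Num.max 1 (ln (x / y)) by rewrite le_max lexx.
have i0 : 0 < (ln 2)^-1 :> R by rewrite invr_gt0.
have [le|lt] := leP x y.
  exists 0%N; rewrite expr0 mulr1; split=> //.
  by rewrite mulrDl; have := mulr_gt0 i0 (lt_le_trans ltr01 max1); lra.
have xy1 : 1 < x / y by rewrite ltr_pdivlMr // mul1r.
pose t := ln (x / y) / ln 2.
have t0 : 0 <= t by apply: divr_ge0; [apply: ln_ge0|]; exact: ltW.
exists (Num.truncn t).+1; have /andP[le1 lt1] := truncn_itv t0; split.
  rewrite mulrC -ler_pdivrMr // -ler_ln ?posrE ?exprn_gt0 //; last first.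
    exact: lt_trans xy1.
  by rewrite lnXn // -[_ *+ _]mulr_natl -ler_pdivrMr // ltW.
have : Num.max 1 (ln (x / y)) >= ln (x / y) by rewrite le_max lexx orbT.
move: max1; set M := Num.max _ _ => max1 leM.
have : t <= (ln 2)^-1 * M by rewrite /t mulrC ler_pM2l.
by rewrite -!natr1 mulrDl; lra.
Qed.

Lemma row_norm_le (R : realType) n (x : 'rV[R]_n) e :
  0 <= e -> (forall i, `|x 0 i| <= e) -> `|x| <= e.
Proof.
move=> e0 h; rewrite [leLHS]mx_normrE; apply: bigmax_le => // -[i j] _ /=.
by rewrite (ord1 i).
Qed.

(** Polynomial bookkeeping: [nS + K] is the cost of one projection call
    including the preparation of its input, and every other cost is dominated,
    up to a constant, by [nA * nS * N.+1] such calls. *)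
Lemma program_time_le nS nA K N : (0 < nS)%N -> (0 < nA)%N ->
  (program_time nS nA K N <= 300 * (nA * nS * (nS + K) * N.+1))%N.
Proof.
move=> S0 A0; rewrite /program_time /solve_time /bisect_time /test_time.
set q := query_time nS K; set U := (nS + K)%N.
have U0 : (0 < U)%N by rewrite addn_gt0 S0.
have hq : (q <= 66 * U)%N by rewrite /q /query_time /U; lia.
have AU : (0 < nA * U)%N by rewrite muln_gt0 A0.
have ht : (nA * (q + 9) <= 75 * (nA * U))%N.
  rewrite mulnCA leq_mul2l; apply/orP; right; lia.
set t := (nA * (q + 9))%N in ht *.
set b := (10 + _)%N.
have hb : (b <= 120 * (nA * U))%N by rewrite /b; lia.
have hN : (N * (9 + b) <= 129 * (nA * U * N))%N.
  rewrite mulnA [leqRHS]mulnC leq_mul2l; apply/orP; right; lia.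
set W := (nA * U * N.+1)%N.
have WE : W = (nA * U * N + nA * U)%N by rewrite /W mulnSr.
have hs : (4 + (4 + (N * (9 + b) + 9 + 4)) + 9 <= 160 * W)%N by lia.
set s := (_ + 9)%N in hs *.
have hS : (nS * s <= 160 * (nS * W))%N.
  rewrite mulnCA leq_mul2l; apply/orP; right; lia.
have SW : (nS <= nS * W)%N by rewrite leq_pmulr // WE; lia.
have UW : (nA * nS <= W)%N.
  rewrite WE; apply: (@leq_trans (nA * U)); last exact: leq_addl.
  by rewrite leq_mul2l leq_addr orbT.
have hi : (nS * nA * nS <= nS * W)%N by rewrite -mulnA leq_mul2l UW orbT.
have -> : (nA * nS * U * N.+1 = nS * W)%N by rewrite /W; lia.
rewrite /init_time; lia.
Qed.

Theorem theorem1 (R : realType)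
    (d : forall nS nA : nat, deviations R nS nA) (h : nat -> R)
    (hd : forall nS nA : nat, deviation_axioms (d nS nA))
    (hproj : projection_computable d h) :
  exists (P : cmd) (C : R), 0 < C /\
    forall (nS nA : nat) (r pbar : 'I_nS -> 'I_nA -> 'rV[R]_nS)
           (lambda kappa eps : R) (v : 'rV[R]_nS) (st : state R),
      (0 < nS)%N -> (0 < nA)%N ->
      (forall s a s', 0 <= r s a 0 s') ->
      (forall s a, simplex (pbar s a)) ->
      0 < lambda < 1 -> 0 < kappa -> 0 < eps ->
      (forall s, 0 <= v 0 s <= Rbar r lambda) ->
      bellman_input r pbar lambda kappa eps v st ->
      exists (st' : state R) (k : nat),
        [/\ exec (d nS nA) P st st' k,
            `|bellman_output nS st' - bellman (d nS nA) r pbar lambda kappa v|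
              <= eps
          & k%:R <= C * (nA%:R * nS%:R * h nS
                         * Num.max 1 (ln (Rbar r lambda / eps)))].
Proof.
case: hproj => Q [c [c0 hQ]].
pose names := iwrites Q ++ rwrites Q.
pose m := (\max_(x <- 6 :: names) x).+1%N.
have le_m x : x \in 6 :: names -> (x < m)%N.
  by move=> hx; rewrite ltnS (big_rem x) //= leq_maxl.
have m6 : (6 < m)%N by apply: le_m; rewrite mem_head.
have Qi x : (m <= x)%N -> x \notin iwrites Q.
  rewrite leqNgt; apply: contra => hx.
  by apply: le_m; rewrite in_cons mem_cat hx orbT.
have Qr x : (m <= x)%N -> x \notin rwrites Q.
  rewrite leqNgt; apply: contra => hx.
  by apply: le_m; rewrite in_cons mem_cat hx !orbT.
have ln20 : 0 < ln 2 :> R by rewrite ln_gt0 // ltr1n.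
pose L : R := 2 + (ln 2)^-1.
have L0 : 0 < L by rewrite addr_gt0 // invr_gt0.
(* Twice the 300 of [program_time_le]: both [nS] and the time of [Q] are at
   most [c * h nS]. *)
exists (bellman_program Q m), (600 * c * L); split.
  by rewrite !mulr_gt0.
move=> nS nA r pbar lambda kappa eps v st S0 A0 r0 hp hl k0 e0 hv hin.
have hS : nS%:R <= c * h nS.
  apply: (projection_time_ge _ d Q) => // a pb b beta st0 h1 h2 h3.
  exact: hQ.
pose K := Num.truncn (c * h nS).
have ch0 : 0 <= c * h nS by apply: le_trans hS.
have lam0 : 0 < 1 - lambda by case/andP: hl; rewrite subr_gt0.
have Rb0 : 0 <= Rbar r lambda.
  by rewrite /Rbar mulr_ge0 ?invr_ge0 ?(ltW lam0) // bigmax_ge_id.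
have [N [hN1 hN2]] := exists_halvings R (Rbar r lambda) eps Rb0 e0.
have hv0 s : 0 <= v 0 s by case/andP: (hv s).
have hv1 s : v 0 s <= Rbar r lambda by case/andP: (hv s).
have hQ' (a : 'I_nA) (pb b : 'rV[R]_nS) (beta : R) (st0 : state R) :
    simplex pb -> (forall i, 0 <= b 0 i) -> 0 <= beta ->
    projection_input a pb b beta st0 ->
    wp R nS nA (d nS nA) Q K (fun st' =>
      projection_output st' = projection (d nS nA) a pb b beta) st0.
  move=> h1 h2 h3 h4; have [st' [k [ex out le]]] := hQ nS nA a pb b beta st0 S0 h1 h2 h3 h4.
  by exists st', k; split=> //; rewrite truncn_ge_nat.
have [st' [k [ex le out]]] := wp_program Q m m6 Qi Qr R nS nA (d nS nA) (hd nS nA)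
  r pbar lambda kappa eps v r0 hp hl hv0 K hQ' A0 k0 e0 hv1 N hN1 st hin.
exists st', k; split=> //.
  apply: row_norm_le => [|s]; first exact: ltW.
  by have := out s; rewrite !mxE add0n.
apply: (@le_trans _ _ (300 * (nA * nS * (nS + K) * N.+1))%:R).
  by rewrite ler_nat (leq_trans le) // program_time_le.
rewrite !natrM natrD.
have hK : K%:R <= c * h nS by rewrite /K truncn_le.
have -> : 600 * c * L * (nA%:R * nS%:R * h nS * Num.max 1 (ln (Rbar r lambda / eps)))
  = 300 * (nA%:R * nS%:R * (c * h nS + c * h nS)
           * (L * Num.max 1 (ln (Rbar r lambda / eps)))) by ring.
rewrite ler_wpM2l // ler_pM ?mulr_ge0 ?addr_ge0 //.
by rewrite ler_wpM2l ?mulr_ge0 // lerD.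
Qed.
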